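(* Let $X$ be a real-valued heavy-tailed random variable with $0<E(X)<\infty$, let $(X_i)_{i\ge1}$ be IID with the law of $X$, let $N$ be a heavy-tailed random variable with values in $\{1,2,3,\dots\}$ independent of $(X_i)$, and put $S_N=\sum_{k=1}^N X_k$. Suppose $E(N^{1+\delta})<\infty$ for some $\delta>0$, and let $h$ be a natural scale of the random variable $E(X)N$ such that $h(x)\ge(1+\delta)\log x$ for all sufficiently large $x$. If there is a natural scale $h_X$ of $X$ with $$\liminf_{x\to\infty}\frac{h_X(x)}{h(x)}\in[1,\infty],$$ then $h$ is a natural scale of $S_N$, i.e. $h\in\mathcal{I}(S_N)$.
   Context: For a random variable $Y$, the hazard function is $R_Y(x):=-\log P(Y>x)$. $Y$ is heavy-tailed if $E(e^{sY})=\infty$ for all $s>0$. For a heavy-tailed $Y$, a natural scale of $Y$ is a concave function $h:[0,\infty)\to[0,\infty)$ with $h(0)=0$, $h(x)\to\infty$ as $x\to\infty$, and $\liminf_{x\to\infty} R_Y(x)/h(x)=1$; $\mathcal{I}(Y)$ denotes the set of natural scales of $Y$. *)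

(* Defs.v *)
From HB Require Import structures.
From mathcomp Require Import all_boot all_order all_algebra.
From mathcomp Require Import all_classical all_reals all_analysis.
Set Implicit Arguments. Unset Strict Implicit. Unset Printing Implicit Defensive.
Import Order.TTheory GRing.Theory Num.Theory.
Import numFieldNormedType.Exports.
Local Open Scope classical_set_scope.
Local Open Scope ring_scope.

Section Defs.
Context {d : measure_display} {T : measurableType d} {R : realType}.
Variable P : probability T R.

Definition heavy_tailed (Y : T -> R) : Prop :=
  forall s : R, 0 < s -> (\int[P]_t (expR (s * Y t))%:E = +oo)%E.

Definition hazard (Y : T -> R) (x : R) : R :=
  - ln (fine (P [set t | x < Y t])).

Definition liminf_pinfty (g : R -> \bar R) : \bar R :=
  limf_einf g (pinfty_nbhs R).

Definition concave_on_nonneg (h : R -> R) : Prop :=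
  forall x y t : R, 0 <= x -> 0 <= y -> 0 <= t <= 1 ->
    t * h x + (1 - t) * h y <= h (t * x + (1 - t) * y).

(* h is a natural scale of the random variable Y; h : [0,oo) -> [0,oo)
   is represented by a function R -> R constrained on [0,oo). *)
Definition natural_scale (Y : T -> R) (h : R -> R) : Prop :=
  concave_on_nonneg h /\
  (forall x : R, 0 <= x -> 0 <= h x) /\
  h 0 = 0 /\
  h x @[x --> +oo] --> +oo /\
  liminf_pinfty (fun x => (hazard Y x / h x)%:E) = 1%E.

Definition mutually_independent (Y : nat -> T -> R) : Prop :=
  forall (J : seq nat) (B : nat -> set R),
    uniq J -> (forall i, measurable (B i)) ->
    P (\bigcap_(i in [set` J]) (Y i @^-1` B i)) =
    (\prod_(i <- J) P (Y i @^-1` B i))%E.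

End Defs.

(* Main.v *)
(** Write [mu] for [E X] and [S_n] for the partial sums.

    Upper bound on the hazard: by the weak law of large numbers
    [P(S_n > n mu / rho) >= 1/2] for large [n], so conditioning on [N] gives
    [P(S_N > y / rho) >= P(mu N > y) / 2], and concavity yields
    [h y <= rho * h (y / rho)].

    Lower bound: fix [x], put [y0 = x / h x], let [s] be the slope of the chord
    of [h] over [[y0, x]] and [L = h y0 - s * y0], so that [L + s x = h x] and
    [h y >= L + s y] on [[y0, x]].  On [N = n] the summands below [y0] have total
    at most [(1 + eta) mu n + eps x] outside an event of probability [e^(- h x)]
    (Chernoff with exponent [1 / (eps y0)]), and some summand exceeds [x] with
    probability at most [n P(X > x)].  Otherwise some summand lies in [(y0, x]],
    and Chernoff with exponent [a s], [a < 1], applied to the summands in that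
    range costs [n q e^(n q) e^(a s ((1 + eta) mu n - (1 - eps) x))] with
    [q = O(e^(- b L))].  Here [h y0 >= (1 + delta) ln y0] makes [n q] of smaller
    order than [h x].  Averaging over [N], whose tail obeys the same chord bound,
    recovers the factor [e^(- L)] that [e^(- s x)] alone misses. *)

Require Import Defs.
From HB Require Import structures.
From mathcomp Require Import all_boot all_order all_algebra.
From mathcomp Require Import all_classical all_reals all_analysis.
From mathcomp Require Import measurable_realfun ring lra.
Import Order.TTheory GRing.Theory Num.Theory.
Import numFieldNormedType.Exports.
Local Open Scope classical_set_scope.
Local Open Scope ring_scope.

(** * Unbounded concave functions and lower limits at infinity *)

Section concave.
Context {R : realType}.
Variable h : R -> R.
Hypothesis hconc : concave_on_nonneg h.
Hypothesis h0 : h 0 = 0.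
Hypothesis hoo : h x @[x --> +oo] --> +oo.

Lemma concave_ge_near (A : R) : \forall x \near +oo, A < h x.
Proof. by move/cvgryPgt: hoo; apply. Qed.

Lemma concave_scale (x c : R) : 0 <= x -> 0 <= c <= 1 -> c * h x <= h (c * x).
Proof.
by move=> x0 c01; have := hconc x 0 c x0 (lexx 0) c01; rewrite h0 !mulr0 !addr0.
Qed.

Lemma concave_scale_ge1 (x c : R) : 0 <= x -> 1 <= c -> h (c * x) <= c * h x.
Proof.
move=> x0 c1; have c0 : 0 < c by lra.
have cx0 : 0 <= c * x by rewrite mulr_ge0// ltW.
have ci : 0 <= c^-1 <= 1 by rewrite invr_ge0 ltW//= invf_le1.
have := concave_scale (c * x) c^-1 cx0 ci.
by rewrite mulKf ?gt_eqF// ler_pdivrMl.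
Qed.

Lemma concave_chord (u x y : R) : 0 <= u -> u <= y <= x -> u < x ->
  h u + (h x - h u) / (x - u) * (y - u) <= h y.
Proof.
move=> u0 /andP[uy yx] ux.
have xu0 : 0 < x - u by lra.
pose t := (y - u) / (x - u).
have t01 : 0 <= t <= 1.
  rewrite /t divr_ge0 ?ler_pdivrMr//=; lra.
have x0 : 0 <= x by lra.
have := hconc x u t x0 u0 t01.
have -> : t * x + (1 - t) * u = y by rewrite /t; field; lra.
apply: le_trans.
by rewrite le_eqVlt; apply/orP; left; apply/eqP; rewrite /t; field; lra.
Qed.

(** Unboundedness supplies a point [z > y] with [h z > h x]. The chord over [[x, z]] then has
    positive slope and lies below [h] at [y]. *)
Lemma concave_nondecreasing (x y : R) : 0 <= x -> x <= y -> h x <= h y.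
Proof.
move=> x0 xy.
have [z [zy hz]] : exists z, y < z /\ h x < h z.
  have : \forall z \near +oo, y < z /\ h x < h z.
    near=> z; split; near: z; first by apply: nbhs_pinfty_gt; exact: num_real.
    exact: concave_ge_near.
  by move/filter_ex.
have xz : x < z by exact: le_lt_trans zy.
have := concave_chord x z y x0; rewrite xy ltW//= => /(_ erefl xz).
apply: le_trans; by rewrite lerDl; apply: mulr_ge0; rewrite ?divr_ge0 ?subr_ge0 ?(ltW xz) ?(ltW hz).
Unshelve. all: by end_near. Qed.

Lemma concave_increasing (x y : R) : 0 <= x -> x < y -> h x < h y.
Proof.
move=> x0 xy.
have [z [zy hz]] : exists z, y < z /\ h y < h z.
  have : \forall z \near +oo, y < z /\ h y < h z.
    near=> z; split; near: z; first by apply: nbhs_pinfty_gt; exact: num_real.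
    exact: concave_ge_near.
  by move/filter_ex.
have xz : x < z by exact: lt_trans zy.
have := concave_chord x z y x0; rewrite (ltW xy) (ltW zy) => /(_ erefl xz).
apply: lt_le_trans; rewrite ltrDl mulr_gt0 ?divr_gt0 ?subr_gt0//.
by apply: le_lt_trans hz; apply: concave_nondecreasing => //; exact: ltW.
Unshelve. all: by end_near. Qed.

Lemma concave_ratio_nonincreasing (x y : R) : 0 < x -> x <= y ->
  h y / y <= h x / x.
Proof.
move=> x0 xy; have y0 : 0 < y by exact: lt_le_trans xy.
have c01 : 0 <= x / y <= 1 by rewrite divr_ge0 ?(ltW x0) ?(ltW y0)//= ler_pdivrMr// mul1r.
have := concave_scale y (x / y) (ltW y0) c01.
by rewrite divfK ?gt_eqF// ler_pdivlMr// mulrAC [h y / y * x]mulrAC [x * h y]mulrC.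
Qed.

End concave.

Section liminf.
Context {R : realType}.
Implicit Types g : R -> R.

Lemma liminf_pinfty_near g (l c : R) :
  (l%:E <= liminf_pinfty (EFin \o g))%E -> c < l ->
  \forall x \near +oo, c < g x.
Proof.
rewrite /liminf_pinfty limf_einfE => lg cl.
have : (c%:E < ereal_sup [set ereal_inf ((EFin \o g) @` V) | V in pinfty_nbhs R])%E.
  by apply: lt_le_trans lg; rewrite lte_fin.
move/ereal_sup_gt => [_ [V FV <-]] cV.
apply: filterS FV => x Vx; rewrite -lte_fin; apply: lt_le_trans cV _.
by apply: ereal_inf_lbound; exists x.
Qed.

Lemma liminf_pinfty_ex g (l c x0 : R) :
  (liminf_pinfty (EFin \o g) <= l%:E)%E -> l < c ->
  exists2 x, x0 < x & g x < c.
Proof.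
rewrite /liminf_pinfty limf_einfE => gl lc.
apply: contrapT => /forall2NP H.
have : (c%:E <= l%:E)%E.
  apply: le_trans gl; apply: le_ereal_sup_tmp.
  exists (ereal_inf ((EFin \o g) @` `]x0, +oo[)).
    exists `]x0, +oo[%classic => //; exists x0; split; first exact: num_real.
    by move=> x; rewrite /= in_itv/= andbT.
  apply: le_ereal_inf_tmp => _ [x + <-]; rewrite /= in_itv/= andbT => x0x.
  rewrite lee_fin; have [//|/negP] := H x.
  by rewrite -leNgt.
by rewrite lee_fin leNgt lc.
Qed.

Lemma liminf_pinfty_eq g (l : R) :
  (forall c, c < l -> \forall x \near +oo, c <= g x) ->
  (forall c x0, l < c -> exists2 x, x0 < x & g x <= c) ->
  liminf_pinfty (EFin \o g) = l%:E.
Proof.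
move=> gel lel; apply/eqP; rewrite /liminf_pinfty limf_einfE eq_le; apply/andP; split.
  apply: ge_ereal_sup => _ [V [M [Mr MV]] <-].
  apply/lee_addgt0Pr => e e0.
  have /(lel _ M)[x Mx gx] : l < l + e by lra.
  apply: le_trans (_ : (g x)%:E <= _)%E; last by rewrite lee_fin.
  by apply: ereal_inf_lbound; exists x => //; exact: MV.
apply/lee_subgt0Pr => e e0.
have le : l - e < l by lra.
apply: le_ereal_sup_tmp; exists (ereal_inf ((EFin \o g) @` [set x | l - e <= g x])).
  by exists [set x | l - e <= g x] => //; exact: gel.
by apply: le_ereal_inf_tmp => _ [x/= gx <-]; rewrite lee_fin.
Qed.

End liminf.

(** * Products of independent variables *)

Section independence.
Context {d : measure_display} {T : measurableType d} {R : realType}.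
Variable P : probability T R.

Import HBNNSimple.

(** The hypothesis is the case where [f] is an indicator. Linearity extends it to simple functions
    and monotone convergence to nonnegative measurable [f]; finiteness of [c] lets multiplication by
    [c] pass to the limit. This replaces one indicator by one function in [integral_prod_indep]. *)
Lemma integral_mul_comp_factor (W Y : T -> R) (c : \bar R) (f : R -> R) :
  measurable_fun setT W -> (forall t, 0 <= W t) -> measurable_fun setT Y ->
  c \is a fin_num ->
  (forall B : set R, measurable B ->
    (\int[P]_t (W t * \1_B (Y t))%:E = c * P (Y @^-1` B))%E) ->
  measurable_fun setT f -> (forall x, 0 <= f x) ->
  (\int[P]_t (W t * f (Y t))%:E = c * \int[P]_t (f (Y t))%:E)%E.
Proof.
move=> mW W0 mY cfin HB mf f0.
have mEf : measurable_fun setT (EFin \o f) by exact/measurable_EFinP.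
pose g n := nnsfun_approx measurableT mEf n.
have mYB (B : set R) : measurable B -> measurable (Y @^-1` B).
  by move=> mB; rewrite -[_ @^-1` _]setTI; exact: mY.
have simple (s : {nnsfun R >-> R}) :
    (\int[P]_t (W t * s (Y t))%:E = c * \int[P]_t (s (Y t))%:E)%E.
  have mI (y : R) : measurable_fun setT (fun t => \1_(s @^-1` [set y]) (Y t) : R).
    by apply: (@measurable_indic _ _ _ _ (Y @^-1` (s @^-1` [set y]))); exact: mYB.
  have yI0 (y : R) t : (0 <= y%:E * (\1_(s @^-1` [set y]) (Y t))%:E)%E.
    exact: nnfun_muleindic_ge0.
  have -> : (\int[P]_t (W t * s (Y t))%:E =
      \int[P]_t \sum_(y \in range s) ((W t)%:E * (y%:E * (\1_(s @^-1` [set y]) (Y t))%:E)))%E.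
    apply: eq_integral => t _; rewrite fimfunE EFinM -fsumEFin// ge0_mule_fsumr//.
    by move=> y; rewrite EFinM yI0.
  have -> : (\int[P]_t (s (Y t))%:E =
      \int[P]_t \sum_(y \in range s) (y%:E * (\1_(s @^-1` [set y]) (Y t))%:E))%E.
    by apply: eq_integral => t _; rewrite fimfunE -fsumEFin.
  rewrite !ge0_integral_fsum//.
  - rewrite ge0_mule_fsumr; last by move=> y; apply: integral_ge0 => t _.
    apply: eq_fsbigr => y /set_mem [x _ sxy].
    have y0 : 0 <= y by rewrite -sxy.
    rewrite ge0_integralZl_EFin//; last exact/measurable_EFinP.
    have -> : (\int[P]_t (\1_(s @^-1` [set y]) (Y t))%:E = P (Y @^-1` (s @^-1` [set y])))%E.
      have -> : (fun t => (\1_(s @^-1` [set y]) (Y t))%:E) =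
                (fun t => (\1_(Y @^-1` (s @^-1` [set y])) t)%:E :> \bar R) by [].
      by rewrite integral_indic ?setIT//; exact: mYB.
    rewrite muleCA -HB//.
    rewrite -ge0_integralZl_EFin//.
    + by apply: eq_integral => t _; rewrite EFinM muleCA.
    + by move=> t _; rewrite lee_fin mulr_ge0.
    + by apply/measurable_EFinP; exact: measurable_funM.
  - by move=> y; apply/measurable_EFinP; exact: measurable_funM.
  - move=> y; apply: emeasurable_funM; first exact/measurable_EFinP.
    by apply/measurable_EFinP; exact: measurable_funM.
  - by move=> y t _; rewrite mule_ge0// lee_fin.
have gcvg t : EFin (g n (Y t)) @[n --> \oo] --> (f (Y t))%:E.
  by apply: (@cvg_nnsfun_approx _ _ _ _ measurableT _ mEf) => // x _; rewrite lee_fin.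
have gnd t : {homo (fun n => g n (Y t)) : m n / (m <= n)%N >-> m <= n}.
  by move=> m n mn; exact/lefP/nd_nnsfun_approx.
have lhs : (\int[P]_t (W t * g n (Y t))%:E @[n --> \oo] --> \int[P]_t (W t * f (Y t))%:E)%E.
  rewrite (_ : (\int[P]_t (W t * f (Y t))%:E =
     \int[P]_t (limn (fun n => (W t * g n (Y t))%:E)))%E); last first.
    apply: eq_integral => t _; apply/esym/cvg_lim => //.
    exact: (cvgeZl (y := (W t)%:E) isT (gcvg t)).
  apply: cvg_monotone_convergence => //.
  - move=> n; apply/measurable_EFinP; apply: measurable_funM => //.
    exact: measurableT_comp.
  - by move=> n t _; rewrite lee_fin mulr_ge0.
  - by move=> t _ m n mn; rewrite lee_fin ler_wpM2l//; exact: gnd.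
have rhs : (\int[P]_t (g n (Y t))%:E @[n --> \oo] --> \int[P]_t (f (Y t))%:E)%E.
  rewrite (_ : (\int[P]_t (f (Y t))%:E = \int[P]_t (limn (fun n => (g n (Y t))%:E)))%E); last first.
    by apply: eq_integral => t _; apply/esym/cvg_lim.
  apply: cvg_monotone_convergence => //.
  - by move=> n; apply/measurable_EFinP; exact: measurableT_comp.
  - by move=> n t _; rewrite lee_fin.
  - by move=> t _ m n mn; rewrite lee_fin; exact: gnd.
have rhs' := cvgeZl cfin rhs.
have lhs' : (\int[P]_t (W t * g n (Y t))%:E @[n --> \oo] --> c * \int[P]_t (f (Y t))%:E)%E.
  by apply: cvg_trans rhs'; apply: near_eq_cvg; apply: nearW => n; rewrite simple.
by rewrite -(cvg_lim _ lhs)// -(cvg_lim _ lhs').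
Qed.

(** Independence is assumed for events only, so the coordinates are converted from indicators to
    functions one at a time. *)
Lemma integral_prod_indep (Y : nat -> T -> R) (f : nat -> R -> R) (J : seq nat) :
  (forall i, measurable_fun setT (Y i)) -> mutually_independent P Y -> uniq J ->
  (forall i, measurable_fun setT (f i)) -> (forall i x, 0 <= f i x) ->
  (forall i, (\int[P]_t (f i (Y i t))%:E < +oo)%E) ->
  (\int[P]_t (\prod_(i <- J) f i (Y i t))%:E =
   \prod_(i <- J) \int[P]_t (f i (Y i t))%:E)%E.
Proof.
move=> mY indep uJ mf f0 ffin.
have mYB i (B : set R) : measurable B -> measurable (Y i @^-1` B).
  by move=> mB; rewrite -[_ @^-1` _]setTI; exact: mY.
have If0 i : (0 <= \int[P]_t (f i (Y i t))%:E)%E.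
  by apply: integral_ge0 => t _; rewrite lee_fin.
pose E (J2 : seq nat) (B : nat -> set R) := \bigcap_(i in [set` J2]) (Y i @^-1` B i).
have mE J2 B : (forall i, measurable (B i)) -> measurable (E J2 B).
  by move=> mB; rewrite /E bigcap_seq; apply: bigsetI_measurable => i _; exact: mYB.
(* Generalised for the induction: the coordinates in [J1] already carry their functions, those in
   [J2] still carry indicators. With [J1] empty this is independence of events. *)
suff H (J1 J2 : seq nat) (B : nat -> set R) : uniq (J1 ++ J2) ->
    (forall i, measurable (B i)) ->
    (\int[P]_t ((\prod_(i <- J1) f i (Y i t)) * \1_(E J2 B) t)%:E =
     (\prod_(i <- J1) \int[P]_t (f i (Y i t))%:E) *
      \prod_(i <- J2) P (Y i @^-1` B i))%E.
  have := H J [::] (fun=> setT); rewrite cats0 => /(_ uJ (fun=> measurableT)).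
  rewrite big_nil mule1 => <-; apply: eq_integral => t _.
  by rewrite /E set_nil bigcap_set0 indicT mulr1.
elim: J1 J2 B => [|i J1 IH] J2 B /= uJJ mB.
  rewrite big_nil mul1e -indep//.
  under eq_integral do rewrite big_nil mul1r.
  by rewrite integral_indic ?setIT//; exact: mE.
move: uJJ => /andP[iJ uJ12].
have iJ2 : i \notin J2 by move: iJ; rewrite mem_cat negb_or => /andP[].
pose W t := (\prod_(j <- J1) f j (Y j t)) * \1_(E J2 B) t.
pose c := ((\prod_(j <- J1) \int[P]_t (f j (Y j t))%:E) *
      \prod_(j <- J2) P (Y j @^-1` B j))%E.
transitivity (\int[P]_t (W t * f i (Y i t))%:E)%E.
  by apply: eq_integral => t _; rewrite big_cons /W; congr EFin; ring.
rewrite big_cons -muleA -/c (@integral_mul_comp_factor W (Y i) c) //.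
- by rewrite muleC.
- apply: measurable_funM; last exact: measurable_indic (mE _ _ mB).
  by apply: measurable_prod => j _; exact: measurableT_comp.
- by move=> t; rewrite mulr_ge0// prodr_ge0.
- rewrite /c fin_numM// prode_fin_num// => j _.
    by rewrite ge0_fin_numE.
  by rewrite fin_num_measure//; exact: mYB.
move=> C mC.
(* Moving [i] into [J2] with the event [C] turns the induction hypothesis into the indicator case
   that [integral_mul_comp_factor] asks for. *)
pose B' j := if j == i then C else B j.
have mB' j : measurable (B' j) by rewrite /B'; case: ifP.
have uJ' : uniq (J1 ++ i :: J2).
  by rewrite -cat1s uniq_catCA /= iJ.
have := IH (i :: J2) B' uJ' mB'.
rewrite big_cons {2}/B' eqxx.
have -> : (\prod_(j <- J2) P (Y j @^-1` B' j) = \prod_(j <- J2) P (Y j @^-1` B j))%E.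
  apply: eq_big_seq => j jJ2; rewrite /B'; case: eqVneq => // ji.
  by move: jJ2; rewrite ji (negbTE iJ2).
rewrite [(P _ * _)%E]muleC muleA -/c => <-.
apply: eq_integral => t _; rewrite /W -mulrA; congr (_ * _)%:E.
have -> : E (i :: J2) B' = E J2 B `&` (Y i @^-1` C).
  rewrite /E !bigcap_seq big_cons setIC {2}/B' eqxx; congr (_ `&` _).
  apply: eq_big_seq => j jJ2; rewrite /B'; case: eqVneq => // ji.
  by move: jJ2; rewrite ji (negbTE iJ2).
by rewrite indicI.
Qed.

End independence.

(** * Tails and exponential moments *)

Section probability_bounds.
Context {d : measure_display} {T : measurableType d} {R : realType}.
Variable P : probability T R.

Lemma measurable_gtr (Y : T -> R) (x : R) :
  measurable_fun setT Y -> measurable [set t | x < Y t].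
Proof.
move=> mY; have -> : [set t | x < Y t] = Y @^-1` `]x, +oo[.
  by apply/seteqP; split => t; rewrite /= in_itv/= andbT.
by rewrite -[_ @^-1` _]setTI; apply: mY.
Qed.

Lemma measurable_ltr (Y : T -> R) (x : R) :
  measurable_fun setT Y -> measurable [set t | Y t < x].
Proof.
move=> mY; have -> : [set t | Y t < x] = Y @^-1` `]-oo, x[.
  by apply/seteqP; split => t; rewrite /= in_itv.
by rewrite -[_ @^-1` _]setTI; apply: mY.
Qed.

Lemma measurable_ler (Y : T -> R) (x : R) :
  measurable_fun setT Y -> measurable [set t | Y t <= x].
Proof.
move=> mY; have -> : [set t | Y t <= x] = Y @^-1` `]-oo, x].
  by apply/seteqP; split => t; rewrite /= in_itv.
by rewrite -[_ @^-1` _]setTI; apply: mY.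
Qed.

Lemma measurable_preimage_nat (N : T -> nat) (B : set nat) :
  measurable_fun setT N -> measurable (N @^-1` B).
Proof. by move=> mN; rewrite -[_ @^-1` _]setTI; apply: mN. Qed.

Lemma measurable_comp_nat (N : T -> nat) (c : nat -> R) :
  measurable_fun setT N -> measurable_fun setT (fun t => c (N t)).
Proof.
move=> mN _ B mB; rewrite setTI.
exact: (@measurable_preimage_nat N (c @^-1` B)).
Qed.

Lemma bigcup_fibre (N : T -> nat) : \bigcup_n (N @^-1` [set n]) = setT.
Proof. by apply/seteqP; split => // t _; exists (N t). Qed.

Lemma trivIset_fibre (N : T -> nat) (A : set T) :
  trivIset setT (fun n => N @^-1` [set n] `&` A).
Proof.
apply/trivIsetP => i j _ _ ij; rewrite -subset0 => t [[/= Ni _] [/= Nj _]].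
by move: ij; rewrite -Ni -Nj eqxx.
Qed.

(** Countable additivity over the level sets of [N]. The number [c n] bounds the conditional
    probability of [A] given [N = n]; the product form avoids dividing by the mass of a null level
    set. *)
Lemma probability_le_fibrewise (N : T -> nat) (A : set T) (c : nat -> R) :
  measurable_fun setT N -> measurable A -> (forall n, 0 <= c n) ->
  (forall n, (P (N @^-1` [set n] `&` A) <= (c n)%:E * P (N @^-1` [set n]))%E) ->
  (P A <= \int[P]_t (c (N t))%:E)%E.
Proof.
move=> mN mA c0 cA.
have mF n : measurable (N @^-1` [set n]) by exact: measurable_preimage_nat.
have -> : P A = (\sum_(0 <= n <oo) P (N @^-1` [set n] `&` A))%E.
  rewrite -measure_semi_bigcup.
  - by rewrite -setI_bigcupl bigcup_fibre setTI.
  - by move=> n; exact: measurableI.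
  - exact: trivIset_fibre.
  - by rewrite -setI_bigcupl bigcup_fibre setTI.
have -> : (\int[P]_t (c (N t))%:E = \sum_(0 <= n <oo) ((c n)%:E * P (N @^-1` [set n])))%E.
  rewrite -[in LHS](bigcup_fibre N) ge0_integral_bigcup//.
  - apply: eq_eseriesr => n _; rewrite -integral_cst//.
    by apply: eq_integral => t /set_mem/= ->.
  - rewrite bigcup_fibre; apply/measurable_EFinP; exact: measurable_comp_nat.
  - by move=> t _; rewrite lee_fin.
  - by have := trivIset_fibre N setT; under eq_fun do rewrite setIT.
by apply: lee_nneseries => n *; [exact: measure_ge0|exact: cA].
Qed.

(** Cut [A] into the slices [k < Z <= k + 1]. Each contributes at most [expR (a * (k + 1)) * D *
    expR (- (b * k))], which is a geometric series of ratio [expR (a - b)]. *)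
Lemma integral_expR_le_of_tail (A : set T) (Z : T -> R) (a b D : R) :
  measurable A -> measurable_fun setT Z -> 0 <= a -> a < b -> 0 <= D ->
  (forall t, A t -> 0 < Z t) ->
  (forall k : nat, (P (A `&` [set t | (k%:R < Z t)%R]) <= (D * expR (- (b * k%:R)))%:E)%E) ->
  (\int[P]_(t in A) (expR (a * Z t))%:E <= (D * (expR a / (1 - expR (a - b))))%:E)%E.
Proof.
move=> mA mZ a0 ab D0 Z0 tailZ.
pose F (k : nat) := A `&` [set t | k%:R < Z t] `&` [set t | Z t <= k.+1%:R].
have mF k : measurable (F k).
  apply: measurableI; last exact: measurable_ler.
  by apply: measurableI => //; exact: measurable_gtr.
have AF : \bigcup_k F k = A.
  apply/seteqP; split => [t [k _ [[]]] //|t At].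
  have exn : exists n : nat, Z t <= n.+1%:R.
    have [n Zn] : exists n : nat, Z t < n%:R.
      exists (Num.bound (Z t)); apply: archi_boundP; exact/ltW/Z0.
    by exists n; rewrite (le_trans (ltW Zn))// ler_nat.
  case: (ex_minnP exn) => n Zn nmin; exists n => //; split => //; split => //=.
  case: n nmin {Zn} => [_|n nmin]; first exact: Z0.
  rewrite ltNge; apply/negP => Zn.
  by have := nmin n Zn; rewrite ltnn.
have tF : trivIset setT F.
  apply/trivIsetP => i j _ _; apply: contraNeq => /set0P[t [[[_ /= iZ] Zi] [[_ /= jZ] Zj]]].
  have ij : (i < j.+1)%N by rewrite -(ltr_nat R); exact: lt_le_trans Zj.
  have ji : (j < i.+1)%N by rewrite -(ltr_nat R); exact: lt_le_trans Zi.
  by rewrite eqn_leq; apply/andP; split; [exact: ij|exact: ji].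
have mexp : measurable_fun setT (fun t => expR (a * Z t)).
  by apply: measurableT_comp => //; exact: measurable_funM.
have z1 : expR (a - b) < 1 by rewrite expR_lt1 subr_lt0.
have z0 : 0 < expR (a - b) by exact: expR_gt0.
rewrite -[in X in (X <= _)%E]AF ge0_integral_bigcup//; last first.
  by apply: measurable_funTS; exact/measurable_EFinP.
apply: lime_le.
  by apply: is_cvg_nneseries => k _ _; apply: integral_ge0 => t _; rewrite lee_fin expR_ge0.
apply: nearW => n.
apply: (@le_trans _ _ (\sum_(0 <= k < n) ((D * expR a) * expR (a - b) ^+ k)%:E)%E).
  apply: lee_sum => k _.
  apply: (@le_trans _ _ (\int[P]_(t in F k) (cst (expR (a * k.+1%:R))%:E t))%E).
    apply: ge0_le_integral => //.
    - by apply: measurable_funTS; exact/measurable_EFinP.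
    - by move=> t [_ /= Zk]; rewrite lee_fin ler_expR ler_wpM2l.
  rewrite integral_cst//=.
  apply: (@le_trans _ _ ((expR (a * k.+1%:R))%:E * (D * expR (- (b * k%:R)))%:E)%E).
    rewrite lee_wpmul2l ?lee_fin ?expR_ge0//; apply: le_trans (tailZ k).
    apply: le_measure; rewrite ?inE//; last by move=> t [].
    by apply: measurableI => //; exact: measurable_gtr.
  rewrite -EFinM lee_fin -expRM_natl mulrCA -!mulrA -!expRD.
  by rewrite le_eqVlt; apply/orP; left; apply/eqP; congr (_ * expR _); rewrite -natr1; ring.
rewrite sumEFin lee_fin.
have -> : \sum_(0 <= k < n) (D * expR a * expR (a - b) ^+ k) =
          series (geometric (D * expR a) (expR (a - b))) n by [].
rewrite geometric_seriesE ?lt_eqF//= mulrA.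
by rewrite ler_pM2r ?invr_gt0 ?subr_gt0// ler_piMr ?mulr_ge0 ?expR_ge0// gerBl exprn_ge0// ltW.
Qed.

(** If the tail vanished at [y], then [expR Y] would be bounded by [expR y] almost surely, against
    heavy-tailedness at [s = 1]. *)
Lemma heavy_tailed_gt0 (Y : T -> R) (y : R) :
  measurable_fun setT Y -> heavy_tailed P Y -> (0 < P [set t | (y < Y t)%R])%E.
Proof.
move=> mY hY; rewrite lt0e measure_ge0 andbT; apply/eqP => P0.
have := hY 1 ltr01; apply/eqP; rewrite lt_eqF//.
apply: (@le_lt_trans _ _ (\int[P]_t (cst (expR y)%:E t))%E); last first.
  by rewrite integral_cst//= probability_setT mule1 ltry.
apply: ae_ge0_le_integral => //.
- apply/measurable_EFinP; apply: measurableT_comp => //; exact: measurable_funM.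
- by move=> t _; rewrite lee_fin expR_ge0.
- exists [set t | y < Y t]; split => //; first exact: measurable_gtr.
  move=> t /= /not_implyP [_ /negP]; rewrite lee_fin -ltNge mul1r.
  by rewrite ltr_expR.
Qed.

(** Dominated convergence: the parts of [|X|] above level [n + 1] tend to 0 pointwise and stay below
    [|X|]. *)
Lemma integrable_tail_le (X : T -> R) (z : R) : P.-integrable setT (EFin \o X) -> 0 < z ->
  exists2 A : R, 0 < A &
    (\int[P]_t (`|X t| * \1_[set x | (A < `|x|)%R] (X t))%:E <= z%:E)%E.
Proof.
move=> iX z0.
have mX : measurable_fun setT X by apply/measurable_EFinP; exact: measurable_int iX.
pose f (n : nat) t := (`|X t| * \1_[set x | n.+1%:R < `|x|] (X t))%:E.
have mf n : measurable_fun setT (f n).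
  apply/measurable_EFinP; apply: measurable_funM; first exact: measurableT_comp.
  apply: (@measurable_indic _ _ _ _ [set t | n.+1%:R < `|X t|]).
  by apply: (@measurable_gtr (fun t => `|X t|)); exact: measurableT_comp.
have : (\int[P]_t f n t @[n --> \oo] --> \int[P]_t (cst 0%E t))%E.
  apply: (@dominated_cvg _ _ _ P setT measurableT f (cst 0%E) (abse \o (EFin \o X))) => //.
  - move=> t _; apply: cvg_near_cst; near=> n.
    rewrite /f indicE memNset ?mulr0//= => /lt_geF.
    suff -> : `|X t| <= n.+1%:R by [].
    rewrite (@le_trans _ _ n%:R) ?ler_nat//.
    near: n; exact: nbhs_infty_ger.
  - exact: integrable_abse.
  - move=> n t _; rewrite /f/= lee_fin normrM normr_id.
    by rewrite ler_piMr// indicE; case: (_ \in _); rewrite ?normr1 ?normr0.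
rewrite integral_cst// mul0e => /fine_cvgP[[k _ kfin] fz].
have /cvgrPdist_le/(_ _ z0)[n _ nz] := fz.
have [m [nm fm]] : exists m : nat, (n <= m)%N /\ (\int[P]_t f m t)%E \is a fin_num.
  by exists (maxn n k); rewrite leq_maxl; split => //; apply: kfin; exact: leq_maxr.
exists m.+1%:R => //.
have := nz m nm; rewrite /= sub0r normrN => /(le_trans (ler_norm _)).
by rewrite -lee_fin fineK.
Unshelve. all: by end_near. Qed.

End probability_bounds.

Section exponential_moments.
Context {d : measure_display} {T : measurableType d} {R : realType}.
Variable P : probability T R.

(** For [u >= -1], multiplying [1 - u <= expR (- u)] by [expR u * (1 + u)] gives
    [expR u <= 1 + u + u ^+ 2 * expR u]. For [u < -1] the right side already exceeds 1, since
    [u + u ^+ 2 > 0]. *)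
Lemma expR_le_quadratic (u M : R) : 0 <= M -> u <= M ->
  expR u <= 1 + u + u ^+ 2 * expR M.
Proof.
move=> M0 uM; have eM : expR u <= expR M by rewrite ler_expR.
have e0 := expR_gt0 u; have u2 := sqr_ge0 u.
have [u1|u1] := leP (-1) u.
  have eNu : expR u * expR (- u) = 1 by rewrite -expRD subrr expR0.
  have := expR_ge1Dx (- u) => eu.
  have : expR u * ((1 - u) * (1 + u)) <= expR u * (expR (- u) * (1 + u)).
    by rewrite ler_pM2l// ler_wpM2r//; lra.
  rewrite [X in _ <= X]mulrA eNu mul1r => H.
  have : u ^+ 2 * expR u <= u ^+ 2 * expR M by rewrite ler_wpM2l.
  have -> : u ^+ 2 * expR u = expR u - expR u * ((1 - u) * (1 + u)) by ring.
  lra.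
have e1 : expR u <= 1 by rewrite expR_le1; lra.
have M1 : 1 <= expR M by rewrite -expR0 ler_expR.
have : u ^+ 2 * 1 <= u ^+ 2 * expR M by rewrite ler_wpM2l.
nra.
Qed.

Lemma expR_le_linear (u M : R) : 0 <= u -> u <= M -> expR u <= 1 + u * expR M.
Proof.
move=> u0 uM; have eM : expR u <= expR M by rewrite ler_expR.
have eNu : expR u * expR (- u) = 1 by rewrite -expRD subrr expR0.
have := expR_ge1Dx (- u); rewrite -(ler_pM2l (expR_gt0 u)) eNu.
have : u * expR u <= u * expR M by rewrite ler_wpM2l.
nra.
Qed.

(* The truncation level M / t keeps the exponent below M while it recedes to
   infinity as t -> 0, so only the first moment of X is needed. *)
Lemma integral_expR_truncated_le (X : T -> R) (m M z : R) :
  P.-integrable setT (EFin \o X) -> (\int[P]_w (X w)%:E = m%:E)%E ->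
  0 < M -> 0 < z ->
  exists2 t0 : R, 0 < t0 & forall t, 0 < t < t0 ->
    (\int[P]_w (expR (t * (X w * \1_`]-oo, (M / t)%R] (X w))))%:E <=
     (1 + t * (m + z))%:E)%E.
Proof.
move=> iX EX M0 z0.
have mX : measurable_fun setT X by apply/measurable_EFinP; exact: measurable_int iX.
have eM0 := expR_gt0 M.
(* The error [t * z] is split in halves. This choice of [A] makes the part of [X] beyond [A],
   weighted by [k = t * (1 + expR M)], cost at most [t * z / 2]; the bound [t0] below does the same
   for the quadratic term [t ^+ 2 * A ^+ 2 * expR M]. *)
have [A A0 tailA] : exists2 A : R, 0 < A &
    (\int[P]_t (`|X t| * \1_[set x | (A < `|x|)%R] (X t))%:E <= (z / 2 / (1 + expR M))%:E)%E.
  by apply: integrable_tail_le => //; rewrite !divr_gt0//; lra.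
pose V w := `|X w| * \1_[set x | A < `|x|] (X w).
have mV : measurable_fun setT V.
  apply: measurable_funM; first exact: measurableT_comp.
  apply: (@measurable_indic _ _ _ _ [set t | A < `|X t|]).
  by apply: (@measurable_gtr _ _ _ (fun t => `|X t|)); exact: measurableT_comp.
have iV : P.-integrable setT (EFin \o V).
  apply: le_integrable iX => //; first exact/measurable_EFinP.
  move=> w _; rewrite /V/= lee_fin normrM normr_id.
  by rewrite ler_piMr// indicE; case: (_ \in _); rewrite ?normr1 ?normr0.
have A2 : 0 < A ^+ 2 by rewrite exprn_gt0.
exists (z / 2 / (A ^+ 2 * expR M)); first by rewrite !divr_gt0// mulr_gt0.
move=> t /andP[t0]; rewrite ltr_pdivlMr ?mulr_gt0// => tt0.
set k := t * (1 + expR M).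
set c := 1 + t ^+ 2 * (A ^+ 2 * expR M).
(* Pointwise majorant [c + t * X + k * V], with [V] the part of [|X|] above [A]. The quadratic bound
   serves where [|X| <= A]. Beyond [A], the term [k * V] absorbs the negative [t * X] or the linear
   bound on the exponential. *)
apply: (@le_trans _ _ (\int[P]_w (c%:E + (t%:E * (X w)%:E + k%:E * (V w)%:E)))%E); last first.
  have it : P.-integrable setT (fun w => t%:E * (X w)%:E)%E by exact: integrableZl.
  have ik : P.-integrable setT (fun w => k%:E * (V w)%:E)%E by exact: integrableZl.
  have ic : P.-integrable setT (cst c%:E) by exact: finite_measure_integrable_cst.
  rewrite integralD//; last exact: integrableD.
  rewrite integralD// integral_cst//= probability_setT mule1.
  rewrite !integralZl// EX.
  apply: (@le_trans _ _ (c%:E + (t%:E * m%:E + k%:E * (z / 2 / (1 + expR M))%:E))%E).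
    by rewrite leeD2l// leeD2l// lee_wpmul2l// lee_fin /k mulr_ge0//; lra.
  rewrite -!EFinM -!EFinD lee_fin /k /c.
  have -> : t * (1 + expR M) * (z / 2 / (1 + expR M)) = t * (z / 2) by field; rewrite gt_eqF// addr_gt0.
  have : t * (t * (A ^+ 2 * expR M)) <= t * (z / 2) by rewrite ler_wpM2l// ltW.
  by rewrite expr2 -mulrA; lra.
have mI : measurable_fun setT (fun w => X w * \1_`]-oo, (M / t)%R] (X w)).
  apply: measurable_funM => //.
  apply: (@measurable_indic _ _ _ _ (X @^-1` `]-oo, (M / t)%R])).
  by rewrite -[_ @^-1` _]setTI; exact: mX.
apply: ge0_le_integral => //.
- apply/measurable_EFinP; apply: measurableT_comp => //; exact: measurable_funM.
- apply: emeasurable_funD => //; apply: emeasurable_funD.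
    by apply/measurable_EFinP; exact: measurable_funM.
  by apply/measurable_EFinP; exact: measurable_funM.
move=> w _; rewrite -!EFinM -!EFinD lee_fin /V /k /c.
have M1 : 1 <= expR M by rewrite -expR0 ler_expR ltW.
set x := X w.
have [xA|Ax] := leP `|x| A.
  rewrite [X in `|x| * X]indicE memNset /= ?ltNge ?xA// mulr0n !mulr0 addr0.
  have x2 : x ^+ 2 <= A ^+ 2.
    by rewrite -real_normK ?num_real// ler_pXn2r// nnegrE// ltW.
  have t2 : 0 <= t ^+ 2 by exact: sqr_ge0.
  have x2e : t ^+ 2 * (x ^+ 2 * expR M) <= t ^+ 2 * (A ^+ 2 * expR M).
    by rewrite ler_wpM2l// ler_wpM2r// ltW.
  have [xM|Mx] := leP x (M / t).
    rewrite indicE mem_set /= ?in_itv//= mulr1.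
    have := @expR_le_quadratic (t * x) M (ltW M0).
    rewrite mulrC -ler_pdivlMr// => /(_ xM).
    by rewrite exprMn [x * t]mulrC -!mulrA; lra.
  rewrite indicE memNset /= ?in_itv/= ?leNgt ?Mx// mulr0 mulr0 expR0.
  have : 0 < M / t by exact: divr_gt0.
  have : 0 < A ^+ 2 * expR M by rewrite mulr_gt0.
  nra.
rewrite [X in `|x| * X]indicE mem_set//= mulr1.
have c0 : 0 <= t ^+ 2 * (A ^+ 2 * expR M).
  by rewrite mulr_ge0 ?sqr_ge0// mulr_ge0 ?sqr_ge0// ltW.
have [x0|x0] := ltP x 0.
  have -> : `|x| = - x by rewrite ltr0_norm.
  have : expR (t * (x * \1_`]-oo, (M / t)%R] x)) <= 1.
    rewrite expR_le1 pmulr_rle0// indicE.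
    by case: (_ \in _); rewrite ?mulr1 ?mulr0// ltW.
  have : 0 <= t * (1 + expR M) * - x - t * - x.
    have -> : t * (1 + expR M) * - x - t * - x = t * - x * expR M by ring.
    by rewrite !mulr_ge0//; lra.
  lra.
rewrite ger0_norm//.
have tx0 : 0 <= t * x by rewrite mulr_ge0// ltW.
have [xM|Mx] := leP x (M / t).
  rewrite indicE mem_set /= ?in_itv//= mulr1.
  have := @expR_le_linear (t * x) M tx0.
  rewrite {1}mulrC -ler_pdivlMr// => /(_ xM).
  nra.
rewrite indicE memNset /= ?in_itv/= ?leNgt ?Mx// !mulr0 expR0.
have : 0 <= t * x * expR M by rewrite mulr_ge0// ltW.
nra.
Qed.

(** Markov's inequality for the part of [|X|] above [A], whose mean is at most [z]: the tail is
    o(1/y), which keeps the maximum of [n] summands below a multiple of [n]. *)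
Lemma probability_norm_gt_le (X : T -> R) (z : R) :
  P.-integrable setT (EFin \o X) -> 0 < z ->
  exists2 A : R, 0 < A & forall y, A <= y ->
    (P [set t | (y < `|X t|)%R] <= (z / y)%:E)%E.
Proof.
move=> iX z0.
have mX : measurable_fun setT X by apply/measurable_EFinP; exact: measurable_int iX.
have [A A0 tailA] := @integrable_tail_le _ _ _ P X z iX z0.
exists A => // y Ay; have y0 : 0 < y by exact: lt_le_trans Ay.
have mA (a : R) : measurable [set t | a < `|X t|].
  by apply: (@measurable_gtr _ _ _ (fun t => `|X t|)); exact: measurableT_comp.
rewrite mulrC EFinM lee_pdivlMl//; apply: le_trans tailA.
rewrite -[P _](_ : \int[P]_t (\1_[set t | y < `|X t|] t)%:E = _)%E; last first.
  by rewrite integral_indic ?setIT.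
have mI : measurable_fun setT (fun t => (\1_[set t | y < `|X t|] t : R)%:E).
  by apply/measurable_EFinP; exact: measurable_indic.
rewrite -ge0_integralZl_EFin//; last exact: ltW.
apply: ge0_le_integral => //.
- by move=> t _; rewrite mule_ge0// lee_fin ltW.
- by apply/measurable_EFinP; apply: measurable_funM => //; exact: measurable_indic.
- apply/measurable_EFinP; apply: measurable_funM; first exact: measurableT_comp.
  exact: (@measurable_indic _ _ _ _ [set t | A < `|X t|]).
move=> t _; rewrite -EFinM lee_fin !indicE.
have [yX|Xy] := ltP y `|X t|.
  rewrite !mem_set//= ?mulr1 ?ltW//; exact: le_lt_trans yX.
rewrite memNset ?mulr0 ?mulr_ge0//=.
by rewrite ltNge Xy.
Qed.

End exponential_moments.

(** * Hazard functions and the tail and moment bounds they give *)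

Section hazard.
Context {d : measure_display} {T : measurableType d} {R : realType}.
Variable P : probability T R.

Lemma fin_num_tail (Y : T -> R) (x : R) : measurable_fun setT Y ->
  P [set t | x < Y t] \is a fin_num.
Proof. by move=> mY; rewrite fin_num_measure//; exact: measurable_gtr. Qed.

(** Positivity of the tail is essential: [ln 0] is 0 by convention, so a vanishing tail would get
    hazard 0 instead of infinity. *)
Lemma le_hazard (Y : T -> R) (x c : R) : measurable_fun setT Y ->
  (0 < P [set t | (x < Y t)%R])%E ->
  (c <= hazard P Y x) = (P [set t | (x < Y t)%R] <= (expR (- c))%:E)%E.
Proof.
move=> mY; rewrite -[P _]fineK ?fin_num_tail// lte_fin lee_fin => p0.
by rewrite /hazard lerNr -[in RHS](lnK p0) ler_expR.
Qed.

Lemma ge_hazard (Y : T -> R) (x c : R) : measurable_fun setT Y ->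
  (0 < P [set t | (x < Y t)%R])%E ->
  (hazard P Y x <= c) = ((expR (- c))%:E <= P [set t | (x < Y t)%R])%E.
Proof.
move=> mY; rewrite -[P _]fineK ?fin_num_tail// lte_fin lee_fin => p0.
by rewrite /hazard lerNl -[in RHS](lnK p0) ler_expR.
Qed.

Lemma tail_le_near (Y : T -> R) (h : R -> R) (b : R) :
  measurable_fun setT Y -> heavy_tailed P Y ->
  h x @[x --> +oo] --> +oo ->
  (\forall x \near +oo, b <= hazard P Y x / h x) ->
  \forall y \near +oo, (P [set t | (y < Y t)%R] <= (expR (- (b * h y)))%:E)%E.
Proof.
move=> mY hY hoo near_b; near=> y.
have h0 : 0 < h y by near: y; exact: concave_ge_near.
rewrite -le_hazard//; last exact: heavy_tailed_gt0.
by rewrite -ler_pdivlMr//; near: y.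
Unshelve. all: by end_near. Qed.

Lemma hazard_ratio_trans (Y : T -> R) (h hY : R -> R) (b : R) :
  h x @[x --> +oo] --> +oo -> hY x @[x --> +oo] --> +oo ->
  (* The two ratios multiply to [hazard P Y x / h x]. Each will eventually exceed [(1 + b) / 2],
     whose square is at least [b]. *)
  (1%:E <= liminf_pinfty (fun x => (hazard P Y x / hY x)%:E))%E ->
  (1%:E <= liminf_pinfty (fun x => (hY x / h x)%:E))%E ->
  0 <= b < 1 -> \forall x \near +oo, b <= hazard P Y x / h x.
Proof.
move=> hoo hYoo l1 l2 /andP[b0 b1]; pose c := (1 + b) / 2.
have c1 : c < 1 by rewrite /c; lra.
have c0 : 0 <= c by rewrite /c; lra.
near=> x.
have h0 : 0 < h x by near: x; exact: concave_ge_near.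
have hY0 : 0 < hY x by near: x; exact: concave_ge_near.
have r1 : c < hazard P Y x / hY x by near: x; exact: liminf_pinfty_near l1 c1.
have r2 : c < hY x / h x by near: x; exact: liminf_pinfty_near l2 c1.
apply: (@le_trans _ _ (c * c)).
  by rewrite /c; have := sqr_ge0 (1 - b); nra.
have -> : hazard P Y x / h x = (hazard P Y x / hY x) * (hY x / h x).
  by field; rewrite !gt_eqF.
by apply: ler_pM => //; exact: ltW.
Unshelve. all: by end_near. Qed.

(* A linear lower bound on h would give Y an exponential moment. *)
Lemma heavy_tailed_sublinear (Y : T -> R) (h : R -> R) (b k : R) :
  concave_on_nonneg h -> h 0 = 0 ->
  measurable_fun setT Y -> (forall t, 0 < Y t) -> heavy_tailed P Y -> 0 < b ->
  (\forall y \near +oo, (P [set t | (y < Y t)%R] <= (expR (- (b * h y)))%:E)%E) ->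
  0 < k -> \forall x \near +oo, h x <= k * x.
Proof.
move=> hconc h0 mY Y0 hY b0 [M [_ tail]] k0.
(* One point with [h x <= k * x] is enough, because [h x / x] is nonincreasing. Otherwise [h]
   dominates [k * x] on the whole positive axis and the tail of [Y] is exponential. *)
have [[x x0 hx]|/forall2NP H] := pselect (exists2 x, 0 < x & h x <= k * x).
  near=> y; have xy : x <= y by near: y; apply: nbhs_pinfty_ge; exact: num_real.
  have y0 : 0 < y by exact: lt_le_trans xy.
  rewrite -ler_pdivrMr//; apply: le_trans (concave_ratio_nonincreasing _ hconc h0 _ _ x0 xy) _.
  by rewrite ler_pdivrMr.
exfalso.
have hk x : 0 < x -> k * x <= h x.
  by move=> x0; have [//|/negP] := H x; rewrite -ltNge => /ltW.
have bk0 : 0 < b * k by exact: mulr_gt0.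
pose Z t := b * k * Y t.
have mZ : measurable_fun setT Z by exact: measurable_funM.
pose M1 := Num.max M 1.
have M10 : 0 < M1 by rewrite lt_max ltr01 orbT.
have half : 0 <= (2^-1 : R) by lra.
have half1 : (2^-1 : R) < 1 by lra.
have := @integral_expR_le_of_tail _ _ _ P setT Z 2^-1 1 (expR (b * k * M1 + b * k))
  measurableT mZ half half1 (expR_ge0 _).
have Z0 t : setT t -> 0 < Z t by move=> _; rewrite mulr_gt0.
move=> /(_ Z0) HZ.
have hs : 0 < 2^-1 * (b * k) by rewrite mulr_gt0// invr_gt0.
have := hY _ hs; apply/eqP; rewrite lt_eqF//.
under eq_integral do rewrite -mulrA.
apply: le_lt_trans (HZ _) _; last by rewrite ltry.
move=> n; rewrite setTI mul1r -expRD.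
have mU : measurable [set t | n%:R < Z t] by exact: measurable_gtr.
have [nM|nM] := leP n%:R (b * k * M1 + b * k).
  apply: le_trans (probability_le1 P mU) _.
  by rewrite lee_fin -[X in X <= _]expR0 ler_expR subr_ge0.
have y1 : M < n%:R / (b * k).
  rewrite ltr_pdivlMr//; apply: le_lt_trans nM; rewrite mulrC.
  have : b * k * M <= b * k * M1 by rewrite ler_pM2l// le_max lexx.
  lra.
have n0 : 0 < n%:R / (b * k).
  rewrite divr_gt0//; apply: le_lt_trans nM.
  by rewrite addr_ge0 ?ltW// mulr_gt0.
have -> : [set t | n%:R < Z t] = [set t | n%:R / (b * k) < Y t].
  by apply/seteqP; split => t /=; rewrite ltr_pdivrMr// mulrC.
apply: le_trans (tail _ y1) _; rewrite lee_fin ler_expR.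
have := hk _ n0; rewrite -(ler_pM2l b0).
have -> : b * (k * (n%:R / (b * k))) = n%:R by field; rewrite !gt_eqF.
have : 0 <= b * k * M1 + b * k by rewrite addr_ge0 ?ltW// mulr_gt0.
lra.
Unshelve. all: by end_near. Qed.

(** On [[y0, x]] concavity puts [h] above its chord [L + s * y], where [L = h y0 - s * y0]. Hence
    [s * Y], restricted to the window, has tail at most [expR (- (b * L)) * expR (- (b * k))], and
    [integral_expR_le_of_tail] applies. *)
Lemma integral_expR_chord_le (Y : T -> R) (h : R -> R) (a b y0 x s : R) :
  concave_on_nonneg h ->
  h y @[y --> +oo] --> +oo -> measurable_fun setT Y ->
  0 <= a -> a < b -> 0 < y0 -> y0 < x ->
  (forall y, y0 <= y -> (P [set t | (y < Y t)%R] <= (expR (- (b * h y)))%:E)%E) ->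
  s = (h x - h y0) / (x - y0) ->
  (\int[P]_t (expR (a * s * Y t) * \1_`]y0, x] (Y t))%:E <=
   (expR (- (b * (h y0 - s * y0))) * (expR a / (1 - expR (a - b))))%:E)%E.
Proof.
move=> hconc hoo mY a0 ab y00 y0x tail sE.
have s0 : 0 < s.
  by rewrite sE divr_gt0 ?subr_gt0//; apply: concave_increasing => //; exact: ltW.
have b0 : 0 < b by exact: le_lt_trans ab.
pose A := Y @^-1` `]y0, x].
have mA : measurable A by rewrite /A -[_ @^-1` _]setTI; exact: mY.
pose Z t := s * Y t.
have mZ : measurable_fun setT Z by exact: measurable_funM.
have -> : (\int[P]_t (expR (a * s * Y t) * \1_`]y0, x] (Y t))%:E =
           \int[P]_(t in A) (expR (a * Z t))%:E)%E.
  rewrite [RHS]integral_mkcond; apply: eq_integral => t _.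
  rewrite patchE indicE /A /Z mulrA.
  have -> : (Y t \in `]y0, x]%classic) = (t \in Y @^-1` `]y0, x]) by [].
  by case: ifP; rewrite ?mulr1 ?mulr0.
apply: integral_expR_le_of_tail => //.
  move=> t; rewrite /A/= in_itv/= => /andP[y0t _].
  by rewrite mulr_gt0//; exact: lt_trans y0t.
(* The maximum with [y0] keeps the level in the range of the tail hypothesis. If it reaches [x], the
   event is empty, as [Y <= x] on the window. *)
move=> k; rewrite -expRD; pose y := Num.max y0 (k%:R / s).
have y0y : y0 <= y by rewrite le_max lexx.
have [xy|yx] := leP x y.
  rewrite (_ : _ `&` _ = set0) ?measure0 ?lee_fin ?expR_ge0//.
  rewrite -subset0 => t []; rewrite /A/= in_itv/= => /andP[y0t tx].
  rewrite /Z mulrC -ltr_pdivrMr// => kt.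
  have : y < Y t by rewrite gt_max y0t.
  by move/(le_lt_trans xy)/(le_lt_trans tx); rewrite ltxx.
apply: (@le_trans _ _ (P [set t | (y < Y t)%R])).
  apply: le_measure; rewrite ?inE.
  - by apply: measurableI => //; exact: measurable_gtr.
  - exact: measurable_gtr.
  - move=> t []; rewrite /A/= in_itv/= => /andP[y0t tx].
    by rewrite /Z mulrC -ltr_pdivrMr// gt_max y0t.
apply: le_trans (tail y y0y) _; rewrite lee_fin ler_expR.
have yk : k%:R <= s * y by rewrite mulrC -ler_pdivrMr// le_max lexx orbT.
have := @concave_chord _ _ hconc y0 x y (ltW y00); rewrite y0y ltW//= => /(_ erefl y0x).
rewrite -sE => hy.
have : b * (h y0 - s * y0 + k%:R) <= b * h y by rewrite ler_pM2l//; lra.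
lra.
Qed.

End hazard.

(** * Random sums *)

Section random_sum.
Context {d : measure_display} {T : measurableType d} {R : realType}.
Variable P : probability T R.
Variables (X : T -> R) (Xs : nat -> T -> R) (N : T -> nat).
Hypothesis mX : measurable_fun setT X.
Hypothesis mXs : forall i, measurable_fun setT (Xs i).
Hypothesis mN : measurable_fun setT N.
Hypothesis idXs : forall i, (0 < i)%N -> forall B : set R, measurable B ->
  P (Xs i @^-1` B) = P (X @^-1` B).
Hypothesis indep : mutually_independent P
  (fun i : nat => if i == 0%N then (fun t => (N t)%:R) else Xs i).

Lemma integral_comp_identical (i : nat) (f : R -> R) : (0 < i)%N ->
  measurable_fun setT f -> (forall x, 0 <= f x) ->
  (\int[P]_t (f (Xs i t))%:E = \int[P]_t (f (X t))%:E)%E.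
Proof.
move=> i0 mf f0.
have mEf : measurable_fun setT (EFin \o f) by exact/measurable_EFinP.
have push (Y : T -> R) (mY : measurable_fun setT Y) :
    (\int[pushforward P Y]_y (f y)%:E = \int[P]_t (f (Y t))%:E)%E.
  rewrite (@ge0_integral_pushforward _ _ _ _ _ Y mY P setT (EFin \o f))//.
  by move=> y _; rewrite lee_fin.
rewrite -(push _ (mXs i)) -(push _ mX); apply: eq_measure_integral => B mB _.
exact: idXs.
Qed.

Lemma measurable_sum_prod (n : nat) (J : seq nat) (f : nat -> nat -> R -> R) (c : R) :
  (forall j k, measurable_fun setT (f j k)) ->
  measurable [set t | 1 <= c * \sum_(j <- J) \prod_(1 <= k < n.+1) f j k (Xs k t)].
Proof.
move=> mf.
have mV : measurable_fun setT
    (fun t => c * \sum_(j <- J) \prod_(1 <= k < n.+1) f j k (Xs k t)).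
  apply: measurable_funM => //; apply: measurable_sum => j.
  by apply: measurable_prod => k _; exact: measurableT_comp.
rewrite (_ : [set t | _] = ~` [set t |
    c * \sum_(j <- J) \prod_(1 <= k < n.+1) f j k (Xs k t) < 1]).
  by apply: measurableC; exact: measurable_ltr.
by apply/seteqP; split => t /=; rewrite leNgt => /negP.
Qed.

Lemma fibre_union (n : nat) (A A1 A2 : set T) (c1 c2 : R) :
  measurable A -> measurable A1 -> measurable A2 -> A `<=` A1 `|` A2 ->
  (P (N @^-1` [set n] `&` A1) <= c1%:E * P (N @^-1` [set n]))%E ->
  (P (N @^-1` [set n] `&` A2) <= c2%:E * P (N @^-1` [set n]))%E ->
  (P (N @^-1` [set n] `&` A) <= (c1 + c2)%:E * P (N @^-1` [set n]))%E.
Proof.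
move=> mA mA1 mA2 A12 H1 H2.
have mF : measurable (N @^-1` [set n]) by exact: measurable_preimage_nat.
have mFA B : measurable B -> measurable (N @^-1` [set n] `&` B) by exact: measurableI.
apply: (@le_trans _ _ (P ((N @^-1` [set n] `&` A1) `|` (N @^-1` [set n] `&` A2)))).
  apply: le_measure; rewrite ?inE; [exact: mFA| |].
    by apply: measurableU; exact: mFA.
  by move=> t [Ft /A12[]]; [left|right].
apply: (@le_trans _ _ (P (N @^-1` [set n] `&` A1) + P (N @^-1` [set n] `&` A2))%E).
  by apply: measureU2; exact: mFA.
by rewrite EFinD muleDl ?fin_num_measure//; exact: leeD.
Qed.

(** Markov's inequality on [N = n] for a sum of products: independence factors each expectation, and
    identical distribution replaces every [Xs k] by [X]. The index [j] typically names the
    exceptional summand of a union bound. *)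
Lemma fibre_markov (n : nat) (J : seq nat) (f : nat -> nat -> R -> R)
    (q : nat -> nat -> R) (c : R) (A : set T) :
  measurable A -> (forall j k, measurable_fun setT (f j k)) ->
  (forall j k x, 0 <= f j k x) -> 0 <= c ->
  (forall j k, (\int[P]_t (f j k (X t))%:E <= (q j k)%:E)%E) ->
  (forall t, A t -> 1 <= c * \sum_(j <- J) \prod_(1 <= k < n.+1) f j k (Xs k t)) ->
  (P (N @^-1` [set n] `&` A) <=
   (c * \sum_(j <- J) \prod_(1 <= k < n.+1) q j k)%:E * P (N @^-1` [set n]))%E.
Proof.
move=> mA mf f0 c0 fq A1.
pose F := N @^-1` [set n].
have mF : measurable F by exact: measurable_preimage_nat.
pose Y (i : nat) := if i == 0%N then (fun t => (N t)%:R : R) else Xs i.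
have mY i : measurable_fun setT (Y i).
  by rewrite /Y; case: ifP => // _; exact: measurable_comp_nat.
(* Coordinate 0 of the independent family is [N]. Giving it the indicator of [n] makes the event
   [N = n] one more factor of the product. *)
pose g j i := if i == 0%N then \1_[set n%:R : R] else f j i.
have mg j i : measurable_fun setT (g j i).
  by rewrite /g; case: ifP => // _; exact: measurable_indic.
have g0 j i x : 0 <= g j i x by rewrite /g; case: ifP.
have g0E j t : g j 0%N (Y 0%N t) = \1_F t.
  rewrite /g /Y/= !indicE; congr (_%:R); congr nat_of_bool.
  apply/idP/idP => /set_mem/= H; apply/mem_set => /=; last by rewrite /F/= in H *; rewrite H.
  by apply/eqP; rewrite -(eqr_nat R); apply/eqP.
have Ig0 j : (\int[P]_t (g j 0%N (Y 0%N t))%:E = P F)%E.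
  under eq_integral do rewrite g0E.
  by rewrite integral_indic ?setIT.
have Ig j k : (0 < k)%N -> (\int[P]_t (g j k (Y k t))%:E = \int[P]_t (f j k (X t))%:E)%E.
  by move=> k0; rewrite /g /Y gtn_eqF//; exact: integral_comp_identical.
have gfin j k : (\int[P]_t (g j k (Y k t))%:E < +oo)%E.
  have [->|k0] := posnP k; first by rewrite Ig0 ltey_eq fin_num_measure.
  by rewrite Ig// (le_lt_trans (fq _ _))// ltry.
have prodE j : (\int[P]_t (\1_F t * \prod_(1 <= k < n.+1) f j k (Xs k t))%:E =
    P F * \prod_(1 <= k < n.+1) \int[P]_t (f j k (X t))%:E)%E.
  have := @integral_prod_indep _ _ _ P Y (g j) (index_iota 0 n.+1) mY indep
    (iota_uniq _ _) (mg j) (g0 j) (gfin j).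
  rewrite big_ltn// Ig0 => H.
  rewrite (eq_big_nat _ _ (F2 := fun k => \int[P]_t (g j k (Y k t))%:E)%E); last first.
    by move=> k /andP[k0 _]; rewrite Ig.
  rewrite -H; apply: eq_integral => t _.
  rewrite [in RHS]big_ltn// g0E; congr (_ * _)%:E; apply: eq_big_nat => k /andP[k0 _].
  by rewrite /g /Y gtn_eqF.
have mprod j : measurable_fun setT (fun t => \1_F t * \prod_(1 <= k < n.+1) f j k (Xs k t)).
  apply: measurable_funM; first exact: measurable_indic.
  by apply: measurable_prod => k _; exact: measurableT_comp.
have prod0 j t : 0 <= \1_F t * \prod_(1 <= k < n.+1) f j k (Xs k t) by rewrite mulr_ge0// prodr_ge0.
have IFA : (P (F `&` A) = \int[P]_t (\1_(F `&` A) t)%:E)%E.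
  by rewrite integral_indic ?setIT//; exact: measurableI.
rewrite IFA.
apply: (@le_trans _ _ (\int[P]_t (c%:E *
    \sum_(j <- J) (\1_F t * \prod_(1 <= k < n.+1) f j k (Xs k t))%:E))%E).
  apply: ge0_le_integral => //.
  - by apply/measurable_EFinP; apply: measurable_indic; exact: measurableI.
  - apply: measurable_funeM; apply: emeasurable_sum => j; exact/measurable_EFinP.
  move=> t _; rewrite sumEFin -EFinM lee_fin.
  have [[Ft At]|nFA] := pselect ((F `&` A) t); last first.
    by rewrite indicE memNset// mulr_ge0// sumr_ge0.
  rewrite indicE mem_set//; under eq_bigr do rewrite indicE mem_set// mul1r.
  exact: A1.
rewrite ge0_integralZl_EFin//; last 2 first.
- by move=> t _; apply: sume_ge0 => j _; rewrite lee_fin.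
- by apply: emeasurable_sum => j; exact/measurable_EFinP.
rewrite ge0_integral_sum//; last 2 first.
- by move=> j; exact/measurable_EFinP.
- by move=> j t _; rewrite lee_fin.
rewrite EFinM -muleA lee_wpmul2l// -sumEFin ge0_sume_distrl; last first.
  move=> j _; rewrite lee_fin prodr_ge0// => k _.
  rewrite -lee_fin; apply: le_trans (fq j k); apply: integral_ge0 => t _.
  by rewrite lee_fin.
apply: lee_sum => j _; rewrite prodE muleC lee_wpmul2r// -prodEFin.
have K0 k : (0 <= \int[P]_t (f j k (X t))%:E)%E by apply: integral_ge0 => t _; rewrite lee_fin.
suff /andP[] : (0 <= \prod_(1 <= k < n.+1) \int[P]_t (f j k (X t))%:E <=
    \prod_(1 <= k < n.+1) (q j k)%:E)%E by [].
apply: (big_ind2 (fun a b : \bar R => (0 <= a <= b)%E)).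
- by rewrite lee01 lexx.
- by move=> a b a' b' /andP[a0 ab] /andP[a'0 ab']; rewrite mule_ge0// lee_pmul.
- by move=> k _; rewrite K0 fq.
Qed.

Lemma sum_prod_ge (n j : nat) (J : seq nat) (f : nat -> nat -> R) :
  uniq J -> j \in J -> (forall j k, 0 <= f j k) ->
  \prod_(1 <= k < n.+1) f j k <= \sum_(j <- J) \prod_(1 <= k < n.+1) f j k.
Proof.
move=> uJ jJ f0; rewrite [X in _ <= X](bigD1_seq j)//= lerDl sumr_ge0// => i _.
exact: prodr_ge0.
Qed.

Lemma prod_single (n j : nat) (a : R) : (0 < j < n.+1)%N ->
  \prod_(1 <= k < n.+1) (if k == j then a else 1) = a.
Proof.
move=> jn; rewrite (bigD1_seq j) ?mem_index_iota ?iota_uniq//= eqxx big1 ?mulr1//.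
by move=> k /negbTE ->.
Qed.

(** Union of three events: a summand exceeds [x] ([A1]), the summands up to [y0] have a large total
    ([A2]), or a summand lies in the window []y0, x]] and the window total is large ([A3]). *)
Lemma fibre_sum_gt_le (n : nat) (x y0 t s q p m e : R) :
  0 <= s -> 0 <= t -> 0 <= q ->
  (\int[P]_w (expR (t * (X w * \1_`]-oo, y0] (X w))))%:E <= (expR (t * m))%:E)%E ->
  (\int[P]_w (expR (s * X w) * \1_`]y0, x] (X w))%:E <= q%:E)%E ->
  (P [set w | (x < X w)%R] <= p%:E)%E ->
  m * n%:R <= (1 - e) * x ->
  (P (N @^-1` [set n] `&` [set w | (x < \sum_(1 <= k < n.+1) Xs k w)%R]) <=
   (n%:R * p + (expR (- (t * (e * x))) +
    n%:R * q * expR (n%:R * q) * expR (s * (m * n%:R - (1 - e) * x))))%:E *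
   P (N @^-1` [set n]))%E.
Proof.
move=> s0 t0 q0 small big tail mn.
pose J := index_iota 1 n.+1.
pose f1 (j k : nat) : R -> R := if k == j then \1_`]x, +oo[ else cst 1.
pose f2 (j k : nat) (y : R) : R := expR (t * (y * \1_`]-oo, y0] y)).
(* The factor of the marked summand [j] has mean at most [q]; any other has mean at most
   [1 + q <= expR q]. Summing over [j] gives [n * q * expR (n * q)]. *)
pose f3 (j k : nat) (y : R) : R :=
  (if k == j then \1_`]y0, x] y else 1) * expR (s * (y * \1_`]y0, x] y)).
pose c2 := expR (- (t * (m * n%:R + e * x))).
pose c3 := expR (s * (m * n%:R - (1 - e) * x)).
have mI (a : set R) : measurable a -> measurable_fun setT (fun y : R => \1_a y : R).
  by move=> ?; exact: measurable_indic.
have mf1 j k : measurable_fun setT (f1 j k) by rewrite /f1; case: ifP => // _; exact: mI.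
have mf2 j k : measurable_fun setT (f2 j k).
  apply: measurableT_comp => //; apply: measurable_funM => //.
  by apply: measurable_funM => //; exact: mI.
have mf3e : measurable_fun setT (fun y : R => expR (s * (y * \1_`]y0, x] y))).
  apply: measurableT_comp => //; apply: measurable_funM => //.
  by apply: measurable_funM => //; exact: mI.
have mf3 j k : measurable_fun setT (f3 j k).
  by apply: measurable_funM => //; case: (k == j) => //; exact: mI.
have f10 j k y : 0 <= f1 j k y by rewrite /f1; case: ifP.
have f20 j k y : 0 <= f2 j k y by rewrite expR_ge0.
have f30 j k y : 0 <= f3 j k y by rewrite mulr_ge0 ?expR_ge0//; case: ifP.
have uJ : uniq J by exact: iota_uniq.
have mJ k : (k \in J) = (0 < k < n.+1)%N by rewrite mem_index_iota.
have eq1 : 1 + q <= expR q by exact: expR_ge1Dx.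
have int1 : (\int[P]_w 1%:E = 1)%E.
  by apply: etrans (integral_cst P measurableT 1%E) _; rewrite /= probability_setT mule1.
pose A1 := [set w | 1 <= 1 * \sum_(j <- J) \prod_(1 <= k < n.+1) f1 j k (Xs k w)].
pose A2 := [set w | 1 <= c2 * \sum_(j <- [:: 0%N]) \prod_(1 <= k < n.+1) f2 j k (Xs k w)].
pose A3 := [set w | 1 <= c3 * \sum_(j <- J) \prod_(1 <= k < n.+1) f3 j k (Xs k w)].
have mA1 : measurable A1 by exact: measurable_sum_prod.
have mA2 : measurable A2 by exact: measurable_sum_prod.
have mA3 : measurable A3 by exact: measurable_sum_prod.
have PA1 : (P (N @^-1` [set n] `&` A1) <= (n%:R * p)%:E * P (N @^-1` [set n]))%E.
  have := @fibre_markov n J f1 (fun j k => if k == j then p else 1) 1 A1 mA1 mf1 f10 ler01.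
  rewrite mul1r big_seq; under eq_bigr => j do
    (rewrite mJ => jn; rewrite (prod_single n j p jn)).
  rewrite -big_seq big_const_seq count_predT size_iota subn1/= iter_addr_0 -[p *+ n]mulr_natl.
  apply => [j k|t' //]; rewrite /f1; case: ifP => _; last first.
    by rewrite int1.
  apply: le_trans tail; rewrite (_ : [set w | x < X w] = X @^-1` `]x, +oo[); last first.
    by apply/seteqP; split => w /=; rewrite in_itv/= andbT.
  rewrite -[X in (_ <= P X)%E]setIT -integral_indic//.
  by rewrite -[_ @^-1` _]setTI; exact: mX.
have PA2 : (P (N @^-1` [set n] `&` A2) <= (expR (- (t * (e * x))))%:E * P (N @^-1` [set n]))%E.
  have := @fibre_markov n [:: 0%N] f2 (fun j k => expR (t * m)) c2 A2 mA2 mf2 f20 (expR_ge0 _).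
  rewrite big_seq1 prodr_const_nat subn1/= -expRM_natr /c2 -expRD.
  rewrite (_ : - (t * (m * n%:R + e * x)) + t * m * n%:R = - (t * (e * x))); last by ring.
  by apply => // j k.
have PA3 : (P (N @^-1` [set n] `&` A3) <=
    (n%:R * q * expR (n%:R * q) * c3)%:E * P (N @^-1` [set n]))%E.
  have := @fibre_markov n J f3 (fun j k => (if k == j then q else 1) * expR q) c3 A3 mA3 mf3 f30
    (expR_ge0 _).
  rewrite big_seq; under eq_bigr => j do
    (rewrite mJ => jn; rewrite big_split/= (prod_single n j q jn)
      prodr_const_nat subn1/= -expRM_natl).
  rewrite -big_seq big_const_seq count_predT size_iota subn1/= iter_addr_0 -[(q * expR (n%:R * q)) *+ n]mulr_natl.
  rewrite mulrC !mulrA; apply => [j k|t' //].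
  have I1 w : \1_`]y0, x] (X w) * expR (s * (X w * \1_`]y0, x] (X w))) =
              expR (s * X w) * \1_`]y0, x] (X w).
    by rewrite indicE; case: (_ \in _); rewrite ?mul1r ?mulr1// mul0r mulr0.
  rewrite /f3; case: ifP => _.
    under eq_integral do rewrite I1.
    apply: le_trans big _; rewrite lee_fin ler_peMr//.
    by rewrite -expR0 ler_expR.
  under eq_integral do rewrite mul1r.
  apply: (@le_trans _ _ (\int[P]_w (1%:E + (expR (s * X w) * \1_`]y0, x] (X w))%:E))%E).
    apply: ge0_le_integral => //.
    - by apply/measurable_EFinP; exact: measurableT_comp mf3e mX.
    - apply: emeasurable_funD => //; apply/measurable_EFinP.
      apply: measurable_funM; first by apply: measurableT_comp => //; exact: measurable_funM.
      exact: measurableT_comp (mI _ _) mX.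
    - move=> w _; rewrite -EFinD lee_fin indicE; case: (_ \in _).
        by rewrite !mulr1 lerDr.
      by rewrite !mulr0 expR0 addr0.
  rewrite ge0_integralD//; last first.
    apply/measurable_EFinP.
    apply: measurable_funM; first by apply: measurableT_comp => //; exact: measurable_funM.
    exact: measurableT_comp (mI _ _) mX.
  rewrite int1.
  by rewrite mul1r; apply: le_trans (leeD2l _ big) _; rewrite -EFinD lee_fin.
have mS : measurable [set w | x < \sum_(1 <= k < n.+1) Xs k w].
  by apply: measurable_gtr; exact: measurable_sum.
apply: (@fibre_union n _ A1 (A2 `|` A3)) => //; first exact: measurableU.
  move=> w /= xS.
  have [a1|na1] := pselect (A1 w); [by left|right].
  have [a2|na2] := pselect (A2 w); [by left|right].
  have Xx k : k \in J -> Xs k w <= x.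
    move=> kJ; rewrite leNgt; apply/negP => xk; apply: na1; rewrite /A1/= mul1r.
    apply: le_trans (@sum_prod_ge n k J (fun j k => f1 j k (Xs k w)) uJ kJ _) => //.
    rewrite big1// => i _; rewrite /f1; case: eqVneq => [->|//].
    by rewrite indicE mem_set//= in_itv/= andbT.
  pose sm := \sum_(1 <= k < n.+1) Xs k w * \1_`]-oo, y0] (Xs k w).
  pose bg := \sum_(1 <= k < n.+1) Xs k w * \1_`]y0, x] (Xs k w).
  have sm_lt : sm < m * n%:R + e * x.
    rewrite ltNge; apply/negP => smge; apply: na2.
    rewrite /A2/= big_seq1 /f2 -expR_sum -mulr_sumr -/sm /c2 -expRD -[X in X <= _]expR0 ler_expR.
    rewrite -mulrN -mulrDr mulr_ge0//; lra.
  have Sbg : \sum_(1 <= k < n.+1) Xs k w = sm + bg.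
    rewrite -big_split/=; apply: eq_big_seq => k kJ.
    have kx := Xx k kJ.
    rewrite !indicE; have [ky|ky] := leP (Xs k w) y0.
      rewrite mem_set/= ?in_itv/= ?ky// memNset/= ?in_itv/= ?ltNge ?ky//.
      by rewrite mulr1 mulr0 addr0.
    rewrite memNset/= ?in_itv/= ?leNgt ?ky// mem_set/= ?in_itv/= ?ky ?kx//.
    by rewrite mulr1 mulr0 add0r.
  have bg_gt : (1 - e) * x - m * n%:R < bg by move: xS; rewrite Sbg; lra.
  (* Without a summand in the window, [bg] would be 0, but it exceeds [(1 - e) * x - m * n], which
     is nonnegative by hypothesis. *)
  have [j jJ jy] : exists2 j, j \in J & `]y0, x]%classic (Xs j w).
    apply: contrapT => /forall2NP nj.
    have bg0 : bg = 0.
      rewrite /bg big1_seq// => k /= kJ; rewrite indicE memNset ?mulr0//.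
      by have [] := nj k.
    by move: bg_gt; rewrite bg0; lra.
  rewrite /A3/=; apply: (@le_trans _ _ (c3 * \prod_(1 <= k < n.+1) f3 j k (Xs k w))).
    rewrite /f3 big_split/= -expR_sum -mulr_sumr -/bg big1 ?mul1r; last first.
      by move=> k _; case: eqVneq => // ->; rewrite indicE mem_set.
    rewrite /c3 -expRD -[X in X <= _]expR0 ler_expR -mulrDr mulr_ge0//; lra.
  rewrite ler_wpM2l ?expR_ge0//.
  exact: (@sum_prod_ge n j J (fun j k => f3 j k (Xs k w))).
by apply: (@fibre_union n _ A2 A3) => //; exact: measurableU.
Qed.

(** A weak law of large numbers in the lower direction. With [t = K / n], the variables [- Xs k] are
    truncated at [1 / t = n / K]. Exceeding that level costs 1/4 by the o(1/y) tail, and Chernoff's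
    bound for the truncated sum costs another 1/4. *)
Lemma fibre_sum_le_half (m mu : R) :
  P.-integrable setT (EFin \o X) -> (\int[P]_w (X w)%:E = mu%:E)%E -> m < mu ->
  exists n0 : nat, forall n, (n0 <= n)%N ->
  (P (N @^-1` [set n] `&` [set w | (\sum_(1 <= k < n.+1) Xs k w <= m * n%:R)%R]) <=
   (2^-1)%:E * P (N @^-1` [set n]))%E.
Proof.
move=> iX EX mmu; pose g := mu - m.
have g0 : 0 < g by rewrite subr_gt0.
(* The Chernoff exponent is [- K * g / 2], so this [K] makes it [-4], and [expR (- 4) <= 1 / 4]. *)
pose K := 8 / g; have K0 : 0 < K by rewrite divr_gt0.
have NX : EFin \o (fun w => - X w) = (fun w => (-1)%:E * (X w)%:E)%E.
  by apply/funext => w /=; rewrite -EFinM mulN1r.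
have iNX : P.-integrable setT (EFin \o (fun w => - X w)).
  by rewrite NX; exact: integrableZl.
have ENX : (\int[P]_w (- X w)%:E = (- mu)%:E)%E.
  rewrite [LHS](_ : _ = \int[P]_w ((-1)%:E * (X w)%:E))%E; last by rewrite -NX.
  by rewrite integralZl// EX -EFinM mulN1r.
have g20 : 0 < g / 2 by rewrite divr_gt0.
have [t0 t00 mgf] := integral_expR_truncated_le _ _ _ _ _ iNX ENX ltr01 g20.
(* At level [n / K] this gives each summand an exceedance probability of at most [1 / (4 * n)],
   hence 1/4 in total. *)
have zK : 0 < (4 * K)^-1 by rewrite invr_gt0 mulr_gt0.
have [A A0 tailA] := probability_norm_gt_le _ _ _ iX zK.
exists (maxn (Num.bound (K / t0)) (Num.bound (K * A))).+1 => n n0n.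
have n0 : 0 < n%:R :> R by rewrite ltr0n; exact: leq_ltn_trans n0n.
have Kt0 : K / t0 < n%:R.
  apply: lt_le_trans (archi_boundP (divr_ge0 (ltW K0) (ltW t00))) _.
  by rewrite ler_nat (leq_trans _ n0n)// (leq_trans (leq_maxl _ _) (leqnSn _)).
have KA : K * A < n%:R.
  apply: lt_le_trans (archi_boundP (mulr_ge0 (ltW K0) (ltW A0))) _.
  by rewrite ler_nat (leq_trans _ n0n)// (leq_trans (leq_maxr _ _) (leqnSn _)).
pose t := K / n%:R; have t_gt0 : 0 < t by rewrite divr_gt0.
have tt0 : t < t0 by rewrite ltr_pdivrMr// mulrC -ltr_pdivrMr.
have t1E : 1 / t = n%:R / K by rewrite div1r invf_div.
have An : A <= n%:R / K by rewrite ler_pdivlMr// mulrC ltW.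
pose J := index_iota 1 n.+1.
pose f1 (j k : nat) : R -> R := if k == j then \1_`]-oo, - (n%:R / K)[ else cst 1.
pose f2 (j k : nat) (y : R) : R := expR (t * (- y * \1_`]-oo, (1 / t)%R] (- y))).
pose c2 := expR (t * (m * n%:R)).
have mf1 j k : measurable_fun setT (f1 j k).
  by rewrite /f1; case: ifP => // _; exact: measurable_indic.
have mf2 j k : measurable_fun setT (f2 j k).
  apply: measurableT_comp => //; apply: measurable_funM => //.
  apply: measurable_funM => //.
  by apply: (measurableT_comp (f := \1_`]-oo, (1 / t)%R] : R -> R)).
have f10 j k y : 0 <= f1 j k y by rewrite /f1; case: ifP.
have f20 j k y : 0 <= f2 j k y by rewrite expR_ge0.
have uJ : uniq J by exact: iota_uniq.
have mJ k : (k \in J) = (0 < k < n.+1)%N by rewrite mem_index_iota.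
have int1 : (\int[P]_w 1%:E = 1)%E.
  by apply: etrans (integral_cst P measurableT 1%E) _; rewrite /= probability_setT mule1.
pose A1 := [set w | 1 <= 1 * \sum_(j <- J) \prod_(1 <= k < n.+1) f1 j k (Xs k w)].
pose A2 := [set w | 1 <= c2 * \sum_(j <- [:: 0%N]) \prod_(1 <= k < n.+1) f2 j k (Xs k w)].
have mA1 : measurable A1 by exact: measurable_sum_prod.
have mA2 : measurable A2 by exact: measurable_sum_prod.
pose p := (4 * K)^-1 / (n%:R / K).
have PA1 : (P (N @^-1` [set n] `&` A1) <= (4^-1)%:E * P (N @^-1` [set n]))%E.
  have := @fibre_markov n J f1 (fun j k => if k == j then p else 1) 1 A1 mA1 mf1 f10 ler01.
  rewrite mul1r big_seq; under eq_bigr => j do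
    (rewrite mJ => jn; rewrite (prod_single n j p jn)).
  rewrite -big_seq big_const_seq count_predT size_iota subn1/= iter_addr_0 -[p *+ n]mulr_natl.
  rewrite (_ : n%:R * p = 4^-1); last by rewrite /p; field; rewrite !gt_eqF.
  apply => [j k|t' //]; rewrite /f1; case: ifP => _; last by rewrite int1.
  apply: le_trans (tailA _ An).
  rewrite -[X in (X <= _)%E](_ : P (X @^-1` `]-oo, - (n%:R / K)[) = _); last first.
    rewrite -[X in (P X = _)%E]setIT -integral_indic//.
    by rewrite -[_ @^-1` _]setTI; exact: mX.
  apply: le_measure; rewrite ?inE.
  - by rewrite -[_ @^-1` _]setTI; exact: mX.
  - by apply: (@measurable_gtr _ _ _ (fun w => `|X w|)); exact: measurableT_comp.
  - move=> w /=; rewrite in_itv/= ltrNr => /lt_le_trans; apply.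
    by rewrite -normrN ler_norm.
have PA2 : (P (N @^-1` [set n] `&` A2) <= (4^-1)%:E * P (N @^-1` [set n]))%E.
  have := @fibre_markov n [:: 0%N] f2 (fun j k => expR (t * (- mu + g / 2))) c2 A2
    mA2 mf2 f20 (expR_ge0 _).
  rewrite big_seq1 prodr_const_nat subn1/= -expRM_natr /c2 -expRD.
  rewrite (_ : t * (m * n%:R) + t * (- mu + g / 2) * n%:R = - 4); last first.
    by rewrite /t /K /g; field; rewrite !gt_eqF.
  move=> H; apply: le_trans (_ : _ <= (expR (- 4))%:E * P (N @^-1` [set n]))%E _.
    apply: H => // j k; apply: le_trans (mgf t _) _; first by rewrite t_gt0.
    by rewrite lee_fin expR_ge1Dx.
  rewrite lee_wpmul2r// lee_fin expRN lef_pV2 ?posrE ?expR_gt0//.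
  by have := expR_ge1Dx (4 : R); lra.
have mS : measurable [set w | \sum_(1 <= k < n.+1) Xs k w <= m * n%:R].
  by apply: measurable_ler; exact: measurable_sum.
rewrite (_ : 2^-1 = 4^-1 + 4^-1 :> R); last by field.
apply: (@fibre_union n _ A1 A2) => // w /= Sm.
have [a1|na1] := pselect (A1 w); [by left|right].
have Xn k : k \in J -> - Xs k w <= 1 / t.
  move=> kJ; rewrite t1E leNgt; apply/negP => xk; apply: na1; rewrite /A1/= mul1r.
  apply: le_trans (@sum_prod_ge n k J (fun j k => f1 j k (Xs k w)) uJ kJ _) => //.
  rewrite big1// => i _; rewrite /f1; case: eqVneq => [->|//].
  by rewrite indicE mem_set//= in_itv/= ltrNr.
rewrite /A2/= big_seq1 /f2 -expR_sum -mulr_sumr.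
rewrite (_ : \sum_(1 <= k < n.+1) - Xs k w * \1_`]-oo, (1 / t)%R] (- Xs k w) =
             - \sum_(1 <= k < n.+1) Xs k w); last first.
  rewrite -sumrN; apply: eq_big_seq => k kJ.
  by rewrite indicE mem_set/= ?in_itv/= ?Xn// mulr1.
rewrite /c2 -expRD -[X in X <= _]expR0 ler_expR -mulrDr.
by apply: mulr_ge0; [exact: ltW|rewrite subr_ge0].
Qed.

(** * Upper and lower tail bounds for the random sum *)

Variable h : R -> R.
Hypothesis hconc : concave_on_nonneg h.
Hypothesis h0 : h 0 = 0.
Hypothesis hoo : h x @[x --> +oo] --> +oo.

Lemma measurable_random_sum :
  measurable_fun setT (fun t => \sum_(1 <= k < (N t).+1) Xs k t).
Proof.
move=> _ B mB; rewrite setTI.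
rewrite (_ : _ @^-1` _ = \bigcup_n (N @^-1` [set n] `&`
    (fun t => \sum_(1 <= k < n.+1) Xs k t) @^-1` B)).
  apply: bigcupT_measurable => n; apply: measurableI.
    exact: measurable_preimage_nat.
  by rewrite -[_ @^-1` _]setTI; apply: measurable_sum.
apply/seteqP; split => [t Bt|t [n _ [/= <-]]//].
by exists (N t).
Qed.

Lemma ge0_integral_combination_le (u v w : T -> R) (k0 k1 k2 bu bv bw : R) :
  measurable_fun setT u -> measurable_fun setT v -> measurable_fun setT w ->
  (forall t, 0 <= u t) -> (forall t, 0 <= v t) -> (forall t, 0 <= w t) ->
  0 <= k0 -> 0 <= k1 -> 0 <= k2 ->
  (\int[P]_t (u t)%:E <= bu%:E)%E -> (\int[P]_t (v t)%:E <= bv%:E)%E ->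
  (\int[P]_t (w t)%:E <= bw%:E)%E ->
  (\int[P]_t (k1 * u t + (k0 + (v t + k2 * w t)))%:E <=
   (k1 * bu + (k0 + (bv + k2 * bw)))%:E)%E.
Proof.
move=> mu mv mw u0 v0 w0 k00 k10 k20 hu hv hw.
have m1 : measurable_fun setT (fun t => k1 * u t) by exact: measurable_funM.
have m2 : measurable_fun setT (fun t => k2 * w t) by exact: measurable_funM.
have m3 : measurable_fun setT (fun t => v t + k2 * w t) by exact: measurable_funD.
have m4 : measurable_fun setT (fun t => k0 + (v t + k2 * w t)) by exact: measurable_funD.
have p1 t : 0 <= k1 * u t by exact: mulr_ge0.
have p2 t : 0 <= k2 * w t by exact: mulr_ge0.
have p3 t : 0 <= v t + k2 * w t by exact: addr_ge0.
have p4 t : 0 <= k0 + (v t + k2 * w t) by exact: addr_ge0.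
have mE (g : T -> R) : measurable_fun setT g -> measurable_fun setT (fun t => (g t)%:E).
  by move=> mg; exact/measurable_EFinP.
have int_add (g1 g2 : T -> R) (b1 b2 : R) : measurable_fun setT g1 -> measurable_fun setT g2 ->
    (forall t, 0 <= g1 t) -> (forall t, 0 <= g2 t) ->
    (\int[P]_t (g1 t)%:E <= b1%:E)%E -> (\int[P]_t (g2 t)%:E <= b2%:E)%E ->
    (\int[P]_t (g1 t + g2 t)%:E <= (b1 + b2)%:E)%E.
  move=> mg1 mg2 g10 g20 gb1 gb2; under eq_integral do rewrite EFinD.
  rewrite ge0_integralD//.
  - by rewrite EFinD leeD.
  - by move=> t _; rewrite lee_fin.
  - exact: mE.
  - by move=> t _; rewrite lee_fin.
  - exact: mE.
have int_scale (g : T -> R) (k b : R) : measurable_fun setT g -> (forall t, 0 <= g t) ->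
    0 <= k -> (\int[P]_t (g t)%:E <= b%:E)%E -> (\int[P]_t (k * g t)%:E <= (k * b)%:E)%E.
  move=> mg g0 kk gb; under eq_integral do rewrite EFinM.
  rewrite ge0_integralZl_EFin//.
  - by rewrite EFinM lee_wpmul2l.
  - by move=> t _; rewrite lee_fin.
  - exact: mE.
apply: (@int_add) => //; first exact: (@int_scale).
have /= := int_add (fun=> k0) (fun t => v t + k2 * w t) k0 (bv + k2 * bw).
apply => //; last by apply: (@int_add) => //; exact: (@int_scale).
by rewrite [X in (X <= _)%E](integral_cst P measurableT k0%:E) /= probability_setT mule1.
Qed.

(** The bound of [fibre_sum_gt_le] with exponent [a * s], averaged over [N]. Taking [a = 1 - 2 * e]
    below the tail exponent [1 - e] makes the geometric series, and so [C], finite. The final loss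
    [5 * e] collects all the slack. *)
Lemma random_sum_tail_le (e m EN C delta x y0 s L t q : R) :
  0 < e -> e <= 1 / 8 -> 0 < m -> 0 < x -> 1 < h x ->
  y0 = x / h x -> y0 <= (1 - e) * x ->
  s = (h x - h y0) / (x - y0) -> L = h y0 - s * y0 ->
  C = expR (1 - 2 * e) / (1 - expR (1 - 2 * e - (1 - e))) ->
  q = expR (- ((1 - e) * L)) * C -> t = (e * y0)^-1 ->
  (\int[P]_w ((N w)%:R)%:E <= EN%:E)%E ->
  (forall y, y0 <= y -> (P [set w | (y < X w)%R] <= (expR (- ((1 - e) * h y)))%:E)%E) ->
  (forall y, y0 <= y -> (P [set w | (y < m * (N w)%:R)%R] <= (expR (- ((1 - e) * h y)))%:E)%E) ->
  (\int[P]_w (expR (t * (X w * \1_`]-oo, y0] (X w))))%:E <= (expR (t * m))%:E)%E ->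
  (1 + delta) * ln y0 <= h y0 ->
  C * expR (1 - e) / m * expR (- (((1 - e) * (1 + delta) - 1) * ln y0)) <= e ->
  (P [set w | (x < \sum_(1 <= k < (N w).+1) Xs k w)%R] <=
   ((EN + 1 + 1 + (EN * expR 1 + 1) * C) * expR (- ((1 - 5 * e) * h x)))%:E)%E.
Proof.
move=> e0 e1 m0 x0 hx1 y0E y0x sE LE CE qE tE hN tailX tailN mgf hlog small.
set H := h x in hx1 y0E sE *.
have H0 : 0 < H by lra.
have y00 : 0 < y0 by rewrite y0E divr_gt0.
have y0ltx : y0 < x by rewrite y0E ltr_pdivrMr// ltr_pMr.
have xy0 : 0 < x - y0 by rewrite subr_gt0.
pose a := 1 - 2 * e.
have a0 : 0 < a by rewrite /a; lra.
have hy0 : 1 <= h y0.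
  have cx : 0 <= y0 / x <= 1.
    by rewrite divr_ge0 ?(ltW y00) ?(ltW x0)//= ler_pdivrMr// mul1r ltW.
  have := @concave_scale _ _ hconc h0 x (y0 / x) (ltW x0) cx.
  by rewrite divfK ?gt_eqF// -/H (_ : y0 / x * H = 1)// y0E; field; rewrite !gt_eqF.
have s0 : 0 < s.
  by rewrite sE divr_gt0// subr_gt0; apply: concave_increasing => //; exact: ltW.
(* Since [h y0 >= 1], the slope is at most [(H - 1) / (x - y0)], which equals [H / x = 1 / y0].
   Hence [L >= h y0 - 1]. *)
have sy0 : s * y0 <= 1.
  have sle : s <= H / x.
    rewrite sE ler_pdivrMr// (_ : H / x * (x - y0) = H - 1); first lra.
    by rewrite y0E; field; rewrite !gt_eqF.
  have : s * y0 <= H / x * y0 by rewrite ler_pM2r.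
  by rewrite (_ : H / x * y0 = 1)// y0E; field; rewrite !gt_eqF.
have L0 : 0 <= L by rewrite LE; lra.
(* With [L >= (1 + delta) * ln y0 - 1], the factor [expR (- ((1 - e) * L))] is at most a constant
   times a negative power of [y0] times [1 / y0 = H / x]. This [H / x] cancels [x], and [small]
   bounds the rest by [e]. *)
have nq : x / m * q <= e * H.
  rewrite qE.
  have bL : - ((1 - e) * L) <= (1 - e) - ((1 - e) * (1 + delta) - 1) * ln y0 - ln y0.
    have : (1 - e) * ((1 + delta) * ln y0 - 1) <= (1 - e) * L.
      by rewrite ler_pM2l; [rewrite LE; lra|lra].
    lra.
  have : expR (- ((1 - e) * L)) <=
      expR (1 - e) * expR (- (((1 - e) * (1 + delta) - 1) * ln y0)) * (H / x).
    rewrite (_ : H / x = expR (- ln y0)); last by rewrite expRN lnK// y0E invf_div.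
    by rewrite -!expRD ler_expR.
  have xC : 0 < x / m * C.
    rewrite mulr_gt0 ?divr_gt0// CE divr_gt0 ?expR_gt0// subr_gt0 expR_lt1; lra.
  rewrite -(ler_pM2l xC) => xCL.
  rewrite [X in X <= _](_ : _ = x / m * C * expR (- ((1 - e) * L))); last by ring.
  apply: le_trans xCL _; rewrite [X in X <= _](_ : _ = C * expR (1 - e) / m *
    expR (- (((1 - e) * (1 + delta) - 1) * ln y0)) * H); last by field; rewrite !gt_eqF.
  by rewrite ler_pM2r.
have LsH : L + s * x = H by rewrite LE sE; field; rewrite gt_eqF.
have C0 : 0 < C.
  rewrite CE divr_gt0 ?expR_gt0// subr_gt0 expR_lt1; lra.
have q0 : 0 < q by rewrite qE mulr_gt0// expR_gt0.
have EN0 : 0 <= EN.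
  by rewrite -lee_fin; apply: le_trans hN; apply: integral_ge0 => w _; rewrite lee_fin.
(* Used twice: for [X], to bound the window summands, and for [m * N], to average the exponential
   factor over [N]. *)
have chord (Y : T -> R) : measurable_fun setT Y ->
    (forall y, y0 <= y -> (P [set w | (y < Y w)%R] <= (expR (- ((1 - e) * h y)))%:E)%E) ->
    (\int[P]_w (expR (a * s * Y w) * \1_`]y0, x] (Y w))%:E <= q%:E)%E.
  move=> mY tailY.
  have := @integral_expR_chord_le _ _ _ P Y h a (1 - e) y0 x s hconc hoo mY (ltW a0).
  rewrite qE LE CE; apply => //; rewrite /a; lra.
pose E0 := expR (- (a * s * ((1 - e) * x))).
pose k2 := E0 * expR (2 * e * H).
pose k1 := expR (- ((1 - e) * H)) + k2 * (expR 1 * q).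
pose v (n : nat) : R := \1_[set n | (1 - e) * x < m * n%:R] n.
pose phi (n : nat) : R := expR (a * s * (m * n%:R)) * \1_`]y0, x] (m * n%:R).
(* Majorant of the conditional probability given [N = n]. The term [v] covers [m * n > (1 - e) * x];
   [k1 * n] covers a summand beyond [x] and the window term when [m * n <= y0]; [expR (- H)] covers
   the small summands; [k2 * phi] covers the window term when [m * n > y0]. *)
pose B (n : nat) : R := k1 * n%:R + (expR (- H) + (v n + k2 * phi n)).
have E00 : 0 < E0 by exact: expR_gt0.
have k20 : 0 < k2 by rewrite mulr_gt0// expR_gt0.
have k10 : 0 <= k1 by rewrite addr_ge0 ?expR_ge0// !mulr_ge0 ?expR_ge0// ltW.
have phi0 n : 0 <= phi n by rewrite mulr_ge0 ?expR_ge0.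
have v0 n : 0 <= v n by rewrite /v.
have mNr : measurable_fun setT (fun w => (N w)%:R : R) by exact: measurable_comp_nat.
have mmN : measurable_fun setT (fun w => m * (N w)%:R) by exact: measurable_funM.
have mS : measurable [set w | x < \sum_(1 <= k < (N w).+1) Xs k w].
  by apply: measurable_gtr; exact: measurable_random_sum.
apply: (@le_trans _ _ (\int[P]_w (B (N w))%:E)%E).
  apply: probability_le_fibrewise => //.
    by move=> n; rewrite /B !addr_ge0 ?expR_ge0 ?mulr_ge0//; exact: ltW.
  move=> n.
  have mF : measurable (N @^-1` [set n]) by exact: measurable_preimage_nat.
  have [mn|mn] := ltP ((1 - e) * x) (m * n%:R).
    apply: (@le_trans _ _ (1%:E * P (N @^-1` [set n]))%E); last first.
      rewrite lee_wpmul2r// lee_fin /B /v indicE mem_set//=.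
      have : 0 <= k1 * n%:R by rewrite mulr_ge0.
      have : 0 <= expR (- H) by rewrite expR_ge0.
      have : 0 <= k2 * phi n by rewrite mulr_ge0// ltW.
      lra.
    rewrite mul1e; apply: le_measure; rewrite ?inE//; first exact: measurableI.
  rewrite (_ : _ `&` _ = N @^-1` [set n] `&` [set w | x < \sum_(1 <= k < n.+1) Xs k w]); last first.
    by apply/seteqP; split => w [/= Nn]; rewrite Nn.
  apply: le_trans (@fibre_sum_gt_le n x y0 t (a * s) q
    (expR (- ((1 - e) * H))) m e _ _ _ mgf (chord X mX tailX) (tailX x (ltW y0ltx)) mn) _.
  - by rewrite mulr_ge0// ltW.
  - by rewrite tE invr_ge0 mulr_ge0// ltW.
  - exact: ltW.
  rewrite lee_wpmul2r// lee_fin /B.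
  have -> : t * (e * x) = H by rewrite tE y0E; field; rewrite !gt_eqF.
  have nqH : n%:R * q <= e * H.
    apply: le_trans nq; rewrite ler_pM2r// ler_pdivlMr// mulrC.
    apply: le_trans mn _; rewrite ler_piMl ?ltW//; lra.
  have eH : e * H <= expR (e * H) by have := expR_ge1Dx (e * H); lra.
  have nq0 : 0 <= n%:R * q by rewrite mulr_ge0// ltW.
  have e2H : expR (2 * e * H) = expR (e * H) * expR (e * H) by rewrite -expRD; congr expR; ring.
  have enq : expR (n%:R * q) <= expR (e * H) by rewrite ler_expR.
  have -> : expR (a * s * (m * n%:R - (1 - e) * x)) = expR (a * s * (m * n%:R)) * E0.
    by rewrite -expRD; congr expR; ring.
  have vn := v0 n.
  have k2phi : 0 <= k2 * phi n by rewrite mulr_ge0// ltW.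
  have eH1 : 1 <= expR (e * H) by rewrite -[X in X <= _]expR0 ler_expR mulr_ge0// ltW.
  suff : n%:R * q * expR (n%:R * q) * (expR (a * s * (m * n%:R)) * E0) <=
         k2 * (expR 1 * q) * n%:R + k2 * phi n.
    by rewrite /k1; lra.
  have [mny|mny] := leP (m * n%:R) y0.
    have eH0 : 0 <= e * H by rewrite mulr_ge0// ltW.
    have t1 : n%:R * q * expR (n%:R * q) <= n%:R * q * expR (e * H + e * H).
      by rewrite ler_wpM2l// ler_expR; lra.
    have t2 : expR (a * s * (m * n%:R)) <= expR 1.
      rewrite ler_expR; apply: le_trans sy0; apply: ler_pM => //.
      - by rewrite mulr_ge0// ltW.
      - by rewrite mulr_ge0// ltW.
      - by rewrite ler_piMl ?(ltW s0)// /a; lra.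
    apply: (@le_trans _ _ (n%:R * q * expR (e * H + e * H) * (expR 1 * E0))).
      apply: ler_pM => //.
      - by rewrite mulr_ge0// expR_ge0.
      - by rewrite mulr_ge0// ?expR_ge0// ltW.
      - by rewrite ler_pM2r.
    rewrite expRD -e2H [X in X <= _](_ : _ = k2 * (expR 1 * q) * n%:R); first by rewrite lerDl.
    by rewrite /k2; ring.
  have -> : phi n = expR (a * s * (m * n%:R)).
    rewrite /phi indicE mem_set ?mulr1//= in_itv/= mny/=.
    by apply: le_trans mn _; rewrite ler_piMl ?ltW//; lra.
  rewrite -[X in X <= _]add0r; apply: lerD.
    by rewrite !mulr_ge0// ?expR_ge0// ?(ltW k20) ?(ltW q0).
  rewrite [X in X <= _](_ : _ = expR (a * s * (m * n%:R)) *
    (E0 * (n%:R * q * expR (n%:R * q)))); last by ring.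
  rewrite [X in _ <= X](_ : _ = expR (a * s * (m * n%:R)) * (E0 * expR (2 * e * H))); last by rewrite /k2; ring.
  rewrite ler_pM2l ?expR_gt0// ler_pM2l// e2H.
  by apply: ler_pM => //; exact: le_trans eH.
have int_phi : (\int[P]_w (phi (N w))%:E <= q%:E)%E by exact: chord.
have int_v : (\int[P]_w (v (N w))%:E <= (expR (- ((1 - e) * h ((1 - e) * x))))%:E)%E.
  apply: le_trans (tailN _ y0x); rewrite -[X in (_ <= P X)%E]setIT -integral_indic//.
  exact: measurable_gtr.
apply: le_trans (@ge0_integral_combination_le (fun w => (N w)%:R) (fun w => v (N w))
  (fun w => phi (N w)) (expR (- H)) k1 k2 EN (expR (- ((1 - e) * h ((1 - e) * x)))) q
  mNr _ _ _ _ _ _ _ _ hN int_v int_phi) _ => //.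
- exact: measurable_comp_nat.
- exact: measurable_comp_nat.
- exact: ltW.
rewrite lee_fin.
set G := expR (- ((1 - 5 * e) * H)).
have G1 : expR (- ((1 - e) * H)) <= G by rewrite ler_expR; nra.
have G2 : expR (- H) <= G by rewrite ler_expR; nra.
have G3 : expR (- ((1 - e) * h ((1 - e) * x))) <= G.
  have c01 : 0 <= 1 - e <= 1 by apply/andP; split; lra.
  have := @concave_scale _ _ hconc h0 x (1 - e) (ltW x0) c01; rewrite -/H => hH.
  rewrite ler_expR lerN2; apply: le_trans (_ : (1 - e) * ((1 - e) * H) <= _); first by nra.
  by rewrite ler_wpM2l//; lra.
(* Here [q], from averaging over [N], supplies the missing power of [expR (- L)]. The exponent is [-
   (1 - 3 * e) * L - (1 - 5 * e + 2 * e ^+ 2) * s * x], at most [- (1 - 5 * e) * (L + s * x)]. *)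
have G4 : k2 * q <= C * G.
  rewrite qE /k2 /E0 mulrA mulrC ler_pM2l// -!expRD ler_expR.
  have : 0 <= e * L by rewrite mulr_ge0// ltW.
  have : 0 <= e * (s * x) by rewrite !mulr_ge0// ltW.
  have : 0 <= e * e * (s * x) by rewrite !mulr_ge0// ltW.
  rewrite -LsH /a; nra.
rewrite /k1.
have : k2 * (expR 1 * q) <= expR 1 * (C * G).
  by rewrite mulrCA ler_pM2l ?expR_gt0.
move=> G5.
have : (expR (- ((1 - e) * H)) + k2 * (expR 1 * q)) * EN <= (G + expR 1 * (C * G)) * EN.
  by rewrite ler_wpM2r// lerD.
lra.
Qed.

(** On [mu * N > y], which forces [N > n0], the event [S_N <= y / rho] implies
    [S_N <= mu / rho * N]. By [half] it takes away at most half of the probability. *)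
Lemma random_sum_tail_ge (mu rho y : R) (n0 : nat) :
  0 < mu -> 0 < rho -> mu * n0%:R <= y ->
  (forall n, (n0 <= n)%N ->
    (P (N @^-1` [set n] `&` [set w | (\sum_(1 <= k < n.+1) Xs k w <= mu / rho * n%:R)%R]) <=
     (2^-1)%:E * P (N @^-1` [set n]))%E) ->
  ((2^-1)%:E * P [set w | (y < mu * (N w)%:R)%R] <=
   P [set w | (y / rho < \sum_(1 <= k < (N w).+1) Xs k w)%R])%E.
Proof.
move=> mu0 rho0 y_ge half.
have mS := measurable_random_sum.
have mmN : measurable_fun setT (fun w => mu * (N w)%:R).
  exact: (@measurable_comp_nat _ _ _ N (fun n => mu * n%:R)).
pose U := [set w | y < mu * (N w)%:R].
pose V := [set w | y / rho < \sum_(1 <= k < (N w).+1) Xs k w].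
pose W := [set w | \sum_(1 <= k < (N w).+1) Xs k w <= y / rho].
have mU : measurable U by exact: measurable_gtr.
have mV : measurable V by exact: measurable_gtr.
have mW : measurable W by exact: measurable_ler.
have mUW : measurable (U `&` W) by exact: measurableI.
pose c (n : nat) : R := 2^-1 * \1_[set n | y < mu * n%:R] n.
have PUW : (P (U `&` W) <= (2^-1)%:E * P U)%E.
  have -> : ((2^-1)%:E * P U = \int[P]_w (c (N w))%:E)%E.
    rewrite -[in LHS](setIT U) -integral_indic// -ge0_integralZl_EFin//.
    by apply/measurable_EFinP; exact: measurable_indic.
  apply: probability_le_fibrewise => //.
    by move=> n; rewrite /c mulr_ge0.
  move=> n.
  have mF : measurable (N @^-1` [set n]) by exact: measurable_preimage_nat.
  have [yn|ny] := ltP y (mu * n%:R); last first.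
    rewrite (_ : _ `&` _ = set0).
      by rewrite measure0 mule_ge0// lee_fin /c mulr_ge0.
    rewrite -subset0 => w [/= Nw [/= yN _]]; move: yN; rewrite /U/= Nw.
    by rewrite ltNge ny.
  rewrite /c indicE mem_set// mulr1.
  have nn : (n0 <= n)%N.
    have : mu * n0%:R < mu * n%:R by exact: le_lt_trans yn.
    by rewrite ltr_pM2l// ltr_nat => /ltnW.
  apply: le_trans (half n nn); apply: le_measure; rewrite ?inE.
  - exact: measurableI.
  - apply: measurableI => //; apply: measurable_ler; exact: measurable_sum.
  move=> w [/= Nw [_ /= Sy]]; split => //=; move: Sy; rewrite /W/= Nw => /le_trans; apply.
  by rewrite mulrAC ler_pM2r ?invr_gt0// ltW.
have PU : (P U <= P V + P (U `&` W))%E.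
  apply: le_trans (measureU2 _ mV mUW); apply: le_measure; rewrite ?inE//.
    exact: measurableU.
  move=> w Uw; have [Vw|Ww] := ltP (y / rho) (\sum_(1 <= k < (N w).+1) Xs k w).
    by left.
  by right.
move: PUW PU; rewrite -/U -/V -(fineK (fin_num_measure P _ mU)) -(fineK (fin_num_measure P _ mV)).
rewrite -(fineK (fin_num_measure P _ mUW)) -!EFinM -EFinD !lee_fin.
lra.
Qed.

End random_sum.

(** * From the tail bounds to the natural scale of the random sum *)

Theorem theorem2p4 (d : measure_display) (T : measurableType d) (R : realType)
  (P : probability T R)
  (X : T -> R) (Xs : nat -> T -> R) (N : T -> nat)
  (delta : R) (h hX : R -> R) :
  measurable_fun setT X ->
  (forall i, measurable_fun setT (Xs i)) ->
  measurable_fun setT N ->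
  (* X heavy-tailed with 0 < E(X) < oo *)
  heavy_tailed P X ->
  P.-integrable setT (EFin \o X) ->
  (0 < \int[P]_t (X t)%:E)%E ->
  (* X_1, X_2, ... have the law of X *)
  (forall i, (0 < i)%N -> forall B : set R, measurable B ->
      P (Xs i @^-1` B) = P (X @^-1` B)) ->
  (* N takes values in {1,2,...} and is heavy-tailed *)
  (forall t, (0 < N t)%N) ->
  heavy_tailed P (fun t => (N t)%:R) ->
  (* N, X_1, X_2, ... are mutually independent *)
  mutually_independent P
    (fun i : nat => if i == 0%N then (fun t => (N t)%:R) else Xs i) ->
  (* E(N^(1+delta)) < oo *)
  0 < delta ->
  (\int[P]_t (((N t)%:R : R) `^ (1 + delta))%:E < +oo)%E ->
  (* h natural scale of E(X) N, with h(x) >= (1+delta) log x eventually *)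
  natural_scale P
    (fun t => fine (\int[P]_u (X u)%:E) * (N t)%:R) h ->
  (\forall x \near +oo, (1 + delta) * ln x <= h x) ->
  (* hX natural scale of X with liminf hX/h in [1, oo] *)
  natural_scale P X hX ->
  (1 <= liminf_pinfty (fun x => (hX x / h x)%:E))%E ->
  natural_scale P (fun t => \sum_(1 <= k < (N t).+1) Xs k t) h.
Proof.
move=> mX mXs mN hvX iX EX0 idXs N1 hvN indep d0 Npow.
move=> [hconc [hge0 [h0 [hoo liN]]]] hlog [_ [_ [_ [hXoo liX]]]] liXh.
set mu := fine _ in liN.
have EX : (\int[P]_t (X t)%:E = mu%:E)%E by rewrite fineK//; exact: integrable_fin_num.
have mu0 : 0 < mu by rewrite -lte_fin -EX.
pose S t := \sum_(1 <= k < (N t).+1) Xs k t.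
have mS : measurable_fun setT S by exact: measurable_random_sum.
pose Y t := mu * (N t)%:R.
have mNr : measurable_fun setT (fun t => (N t)%:R : R) by exact: measurable_comp_nat.
have mY : measurable_fun setT Y by exact: measurable_funM.
have Y0 t : 0 < Y t by rewrite mulr_gt0// ltr0n.
have hvY : heavy_tailed P Y.
  move=> s s0; rewrite /Y; under eq_integral do rewrite mulrA.
  by apply: hvN; rewrite mulr_gt0.
pose gY x := hazard P Y x / h x.
have liY : liminf_pinfty (EFin \o gY) = 1%E := liN.
have tailY b : b < 1 ->
    \forall y \near +oo, (P [set t | (y < Y t)%R] <= (expR (- (b * h y)))%:E)%E.
  move=> b1; apply: tail_le_near => //.
  have li1 : (1%:E <= liminf_pinfty (EFin \o gY))%E by rewrite liY.
  by apply: filterS (liminf_pinfty_near _ _ _ li1 b1) => x; exact: ltW.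
have tailX b : 0 <= b < 1 ->
    \forall y \near +oo, (P [set t | (y < X t)%R] <= (expR (- (b * h y)))%:E)%E.
  move=> b1; apply: tail_le_near => //.
  by apply: (hazard_ratio_trans _ _ _ hX) => //; rewrite liX.
(* Sublinearity of [h] is what sends the threshold [y0 = x / h x] to infinity. *)
have sub k : 0 < k -> \forall x \near +oo, h x <= k * x.
  have half1 : 2^-1 < 1 :> R by lra.
  by apply: (heavy_tailed_sublinear P Y h 2^-1) => //; exact: tailY.
have [EN hEN] : exists EN : R, (\int[P]_t ((N t)%:R)%:E <= EN%:E)%E.
  exists (fine (\int[P]_t (((N t)%:R : R) `^ (1 + delta))%:E)).
  rewrite fineK; last first.
    rewrite ge0_fin_numE//; apply: integral_ge0 => t _.
    by rewrite lee_fin powR_ge0.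
  apply: ge0_le_integral => //.
  - exact/measurable_EFinP.
  - apply/measurable_EFinP; exact: (@measurable_comp_nat _ _ _ N (fun n => (n%:R : R) `^ (1 + delta))).
  - move=> t _; rewrite lee_fin -[X in X <= _]powRr1//.
    by apply: ler_powR; [rewrite ler1n|lra].
(* Upper bound on the hazard of [S] at arbitrarily large points, obtained from points [y = rho * x]
   where the hazard ratio of [Y] is below [rho]. *)
have lower c x0 : 1 < c -> exists2 x, x0 < x &
    ((expR (- (c * h x)))%:E <= P [set t | (x < S t)%R])%E.
  (* The two factors [rho = 1 + u] cost [rho * rho <= 1 + 3 * u]. One more [u] absorbs the factor
     1/2, since [u * h x >= 1]; the total [1 + 4 * u] is at most [c]. *)
  move=> c1; pose u := Num.min 1 (c - 1) / 4.
  have u0 : 0 < u by rewrite divr_gt0// lt_min ltr01 subr_gt0.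
  have u1 : u <= 1 / 4 by rewrite ler_pM2r ?invr_gt0// ge_min lexx.
  have uc : 4 * u <= c - 1 by rewrite mulrC divfK// ge_min lexx orbT.
  pose rho := 1 + u; have rho0 : 0 < rho by rewrite /rho; lra.
  have rho1 : 1 < rho by rewrite /rho; lra.
  have murho : mu / rho < mu by rewrite ltr_pdivrMr// ltr_pMr.
  have [n0 half] := fibre_sum_le_half P X Xs N mX mXs mN idXs indep _ _ iX EX murho.
  have [M [_ hM]] := concave_ge_near _ hoo u^-1.
  pose x1 := Num.max (Num.max x0 M) (Num.max 0 (mu * n0%:R)).
  have li1 : (liminf_pinfty (EFin \o gY) <= 1%:E)%E by rewrite liY.
  have [y x1y Yy] := liminf_pinfty_ex _ _ _ (rho * x1) li1 rho1.
  pose x := y / rho.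
  have x1x : x1 < x by rewrite ltr_pdivlMr// mulrC.
  move: (x1x); rewrite !gt_max => /andP[/andP[x0x Mx] /andP[xgt0 nx]].
  have yE : y = rho * x by rewrite /x mulrCA divff ?mulr1// gt_eqF.
  have hx := hM _ Mx.
  have hx0 : 0 < h x by apply: lt_trans hx; rewrite invr_gt0.
  have xy : x <= y by rewrite yE ler_peMl ?(ltW xgt0)// ltW.
  have hy0 : 0 < h y.
    by apply: lt_le_trans hx0 _; apply: concave_nondecreasing => //; exact: ltW.
  have hyx : h y <= rho * h x.
    by rewrite yE; apply: concave_scale_ge1 => //; exact: ltW.
  exists x => //.
  have ny : mu * n0%:R <= y by apply: le_trans xy; exact: ltW.
  apply: le_trans (random_sum_tail_ge P Xs N mXs mN mu rho y n0 mu0 rho0 ny half).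
  have : hazard P Y y <= rho * h y by rewrite -ler_pdivrMr// ltW.
  rewrite ge_hazard//; last exact: heavy_tailed_gt0.
  move=> PY; apply: (@le_trans _ _ ((2^-1)%:E * (expR (- (rho * h y)))%:E)%E); last first.
    by rewrite lee_wpmul2l.
  rewrite -EFinM lee_fin.
  apply: (@le_trans _ _ (expR (- 1) * expR (- (rho * h y)))); last first.
    rewrite ler_pM2r ?expR_gt0// expRN lef_pV2 ?posrE ?expR_gt0//.
    by have := expR_ge1Dx (1 : R); lra.
  rewrite -expRD ler_expR.
  have uhx : 1 <= u * h x by rewrite -ler_pdivrMl// mulr1 ltW.
  have : rho * h y <= rho * (rho * h x) by rewrite ler_pM2l.
  have : rho * rho * h x <= (1 + 3 * u) * h x.
    by rewrite ler_pM2r// /rho; nra.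
  have : (1 + 4 * u) * h x <= c * h x by rewrite ler_pM2r//; lra.
  lra.
(* The tail of [S] never vanishes, so its hazard may be converted into a tail bound and back. *)
have PS0 x : (0 < P [set t | (x < S t)%R])%E.
  have c12 : 1 < 2 :> R by lra.
  have [z xz Pz] := lower 2 x c12.
  apply: (@lt_le_trans _ _ (expR (- (2 * h z)))%:E); first by rewrite lte_fin expR_gt0.
  apply: le_trans Pz _; apply: le_measure; rewrite ?inE; try exact: measurable_gtr.
  by move=> t /=; exact: lt_trans.
split => //; split => //; split => //; split => //.
rewrite (_ : liminf_pinfty _ = liminf_pinfty (EFin \o (fun x => hazard P S x / h x)))//.
apply: liminf_pinfty_eq => [c c1|c x0 c1]; last first.
  have [M [_ hM]] := concave_ge_near _ hoo 0.
  have [x] := lower c (Num.max x0 M) c1; rewrite gt_max => /andP[x0x Mx] Px.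
  exists x => //; rewrite ler_pdivrMr; last exact: hM.
  by rewrite ge_hazard.
(* The second bound leaves room for a total loss of [6 * e] below 1; the third gives
   [r >= delta / 2], so [y0] to the power [- r] tends to 0. *)
pose e := Num.min (1 / 8) (Num.min ((1 - c) / 6) (delta / (2 * (1 + delta)))).
have d1 : 0 < 1 + delta by lra.
have e0 : 0 < e.
  by rewrite !lt_min; apply/andP; split; [|apply/andP; split; rewrite divr_gt0//]; lra.
have e8 : e <= 1 / 8 by rewrite ge_min lexx.
have ec : e <= (1 - c) / 6 by rewrite !ge_min lexx orbT.
have ed : e <= delta / (2 * (1 + delta)) by rewrite !ge_min lexx !orbT.
pose r := (1 - e) * (1 + delta) - 1.
have r0 : 0 < r.
  have : e * (1 + delta) <= delta / (2 * (1 + delta)) * (1 + delta) by rewrite ler_pM2r.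
  rewrite (_ : delta / (2 * (1 + delta)) * (1 + delta) = delta / 2).
    by rewrite /r; lra.
  by field; rewrite gt_eqF.
pose m := mu * (1 + e / 2).
have m0 : 0 < m by rewrite mulr_gt0//; lra.
pose C := expR (1 - 2 * e) / (1 - expR (1 - 2 * e - (1 - e))).
have C0 : 0 < C by rewrite divr_gt0 ?expR_gt0// subr_gt0 expR_lt1; lra.
have i0 : 0 < 1 / e by rewrite divr_gt0.
have z0 : 0 < mu * (e / 2) by rewrite mulr_gt0// divr_gt0.
(* With [M = 1 / e], the truncation level [M / t] at [t = 1 / (e * y0)] is exactly [y0]. *)
have [t0 t00 mgf] := integral_expR_truncated_le P X mu (1 / e) (mu * (e / 2)) iX EX i0 z0.
have tailm : \forall y \near +oo,
    (P [set w | (y < m * (N w)%:R)%R] <= (expR (- ((1 - e) * h y)))%:E)%E.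
  (* Half of the slack [e] goes to the tail exponent and half to the dilation from [mu] to [m]:
     [(1 - e) * (1 + e / 2) <= 1 - e / 2]. *)
  have b1 : 1 - e / 2 < 1 by lra.
  have [M [_ tM]] := tailY _ b1.
  have g0 : 0 < 1 + e / 2 by lra.
  near=> y.
  have y0 : 0 <= y by near: y; apply: nbhs_pinfty_ge; exact: num_real.
  have yM : M < y / (1 + e / 2).
    by rewrite ltr_pdivlMr//; near: y; apply: nbhs_pinfty_gt; exact: num_real.
  rewrite (_ : [set w | _] = [set w | y / (1 + e / 2) < Y w]); last first.
    by apply/seteqP; split => w /=; rewrite ltr_pdivrMr// /Y /m mulrAC.
  apply: le_trans (tM _ yM) _; rewrite lee_fin ler_expR lerN2.
  have c01 : 0 <= (1 + e / 2)^-1 <= 1.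
    by rewrite invr_ge0 (ltW g0)/= invf_le1//; lra.
  have := concave_scale _ hconc h0 y _ y0 c01; rewrite mulrC [_^-1 * y]mulrC => hsc.
  apply: (@le_trans _ _ ((1 - e / 2) * (h y / (1 + e / 2)))); last first.
    by rewrite ler_pM2l//; lra.
  rewrite mulrA ler_pdivlMr// mulrAC ler_wpM2r ?hge0//; nra.
have b01 : 0 <= 1 - e < 1 by apply/andP; split; lra.
(* Once [ln y0 >= B], the factor [expR (- (r * ln y0))] is at most [e * m / (C * expR (1 - e))],
   which is the smallness condition of [random_sum_tail_le]. *)
pose B := - ln (e * m / (C * expR (1 - e))) / r.
have [Ys [Ys0 good]] : exists Ys : R, 0 < Ys /\ forall y, Ys <= y ->
    [/\ (P [set w | (y < X w)%R] <= (expR (- ((1 - e) * h y)))%:E)%E,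
        (P [set w | (y < m * (N w)%:R)%R] <= (expR (- ((1 - e) * h y)))%:E)%E,
        (1 + delta) * ln y <= h y, (e * t0)^-1 < y & expR B <= y].
  have : \forall y \near +oo,
    [/\ (P [set w | (y < X w)%R] <= (expR (- ((1 - e) * h y)))%:E)%E,
        (P [set w | (y < m * (N w)%:R)%R] <= (expR (- ((1 - e) * h y)))%:E)%E,
        (1 + delta) * ln y <= h y, (e * t0)^-1 < y & expR B <= y].
    near=> y; split; near: y => //; first exact: tailX.
      by apply: nbhs_pinfty_gt; exact: num_real.
    by apply: nbhs_pinfty_ge; exact: num_real.
  move=> [M [_ gM]]; exists (Num.max M 0 + 1); split.
    by rewrite ltr_wpDl// le_max lexx orbT.
  move=> y My; apply: gM; apply: lt_le_trans My.
  by apply: (@le_lt_trans _ _ (Num.max M 0)); [rewrite le_max lexx|rewrite ltrDl].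
pose C1 := EN + 1 + 1 + (EN * expR 1 + 1) * C.
have Ysi : 0 < Ys^-1 by rewrite invr_gt0.
near=> x.
have x0 : 0 < x by near: x; apply: nbhs_pinfty_gt; exact: num_real.
have hx2 : 2 < h x by near: x; exact: concave_ge_near.
have hxC : C1 / e < h x by near: x; exact: concave_ge_near.
have hxY : h x <= Ys^-1 * x by near: x; exact: sub.
have hx0 : 0 < h x by lra.
pose y0 := x / h x.
have y0Y : Ys <= y0 by rewrite /y0 ler_pdivlMr// -ler_pdivlMl.
have y00 : 0 < y0 by exact: lt_le_trans y0Y.
have [gX gN glog gt gB] := good y0 y0Y.
have tail1 y : y0 <= y -> (P [set w | (y < X w)%R] <= (expR (- ((1 - e) * h y)))%:E)%E.
  by move=> y0y; have [] := good y (le_trans y0Y y0y).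
have tail2 y : y0 <= y -> (P [set w | (y < m * (N w)%:R)%R] <= (expR (- ((1 - e) * h y)))%:E)%E.
  by move=> y0y; have [] := good y (le_trans y0Y y0y).
pose t := (e * y0)^-1.
have t_gt0 : 0 < t by rewrite invr_gt0 mulr_gt0.
have tt0 : t < t0.
  have gt1 : 1 < y0 * (e * t0) by rewrite -ltr_pdivrMr ?mulr_gt0// div1r.
  rewrite /t -div1r (ltr_pdivrMr _ _ (mulr_gt0 e0 y00)); lra.
have mgf1 : (\int[P]_w (expR (t * (X w * \1_`]-oo, y0] (X w))))%:E <= (expR (t * m))%:E)%E.
  have := mgf t; rewrite t_gt0 tt0 => /(_ erefl).
  rewrite (_ : 1 / e / t = y0); last by rewrite /t invrK; field; rewrite gt_eqF.
  move/le_trans; apply; rewrite lee_fin (_ : mu + mu * (e / 2) = m); last by rewrite /m; ring.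
  exact: expR_ge1Dx.
have y0x : y0 <= (1 - e) * x.
  have eh : 1 <= (1 - e) * h x.
    have : (1 - e) * 2 <= (1 - e) * h x by rewrite ler_wpM2l//; lra.
    lra.
  by rewrite /y0 ler_pdivrMr// mulrAC ler_peMl// ltW.
have small : C * expR (1 - e) / m * expR (- (r * ln y0)) <= e.
  have Bln : B <= ln y0 by rewrite -ler_expR lnK.
  have em0 : 0 < e * m / (C * expR (1 - e)).
    by apply: divr_gt0; apply: mulr_gt0 => //; exact: expR_gt0.
  have : expR (- (r * ln y0)) <= e * m / (C * expR (1 - e)).
    rewrite -[X in _ <= X]lnK// ler_expR lerNl.
    by move: Bln; rewrite /B ler_pdivrMr// [ln y0 * r]mulrC.
  have k0 : 0 < C * expR (1 - e) / m.
    by apply: divr_gt0 => //; apply: mulr_gt0 => //; exact: expR_gt0.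
  rewrite -(ler_pM2l k0) => /le_trans; apply.
  rewrite le_eqVlt; apply/orP; left; apply/eqP; field.
  by rewrite !gt_eqF// expR_gt0.
have hx1 : 1 < h x by lra.
have := random_sum_tail_le P X Xs N mX mXs mN idXs indep h hconc h0 hoo e m EN C delta x y0
  _ _ t _ e0 e8 m0 x0 hx1 erefl y0x erefl erefl erefl erefl erefl hEN tail1 tail2 mgf1 glog small.
rewrite -/C1 => PS.
rewrite ler_pdivlMr// le_hazard//; apply: le_trans PS _; rewrite lee_fin.
(* The constant [C1] is below [e * h x], hence below [expR (e * h x)]; this is the sixth and last
   loss of [e]. *)
apply: (@le_trans _ _ (expR (e * h x) * expR (- ((1 - 5 * e) * h x)))).
  rewrite ler_pM2r ?expR_gt0//.
  have : C1 < e * h x by rewrite mulrC -ltr_pdivrMr.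
  by have := expR_ge1Dx (e * h x); lra.
rewrite -expRD ler_expR.
have : c * h x <= (1 - 6 * e) * h x by rewrite ler_pM2r//; lra.
lra.
Unshelve. all: by end_near. Qed.
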